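(* Let $A=\{1,\dots,d\}$ and let $\gamma_1,\dots,\gamma_d\in\,]0,1[$ be such that $\sum_{i=1}^d k_i\gamma_i\ne1$ for all non-negative integers $k_1,\dots,k_d$. One can associate to each collection $x=(x^i)_{i=1,\dots,d}$ with $x^i\in C^{\gamma_i}([0,1])$ an anisotropic geometric rough path $\bar X=\bar X(x)$ over $x$, with exponents $(\gamma_i)_{i=1,\dots,d}$, i.e. such that $\langle \bar X_{st},i\rangle=x^i_t-x^i_s$ for all $i\in A$ and $s,t\in[0,1]$, in such a way that the following holds. For every collection $g=(g^i)_{i=1,\dots,d}$ with $g^i\in C^{\gamma_i}([0,1])$, denoting by $g\bar X$ the anisotropic geometric rough path $\bar X(x+g)$ associated to $(x^i+g^i)_{i=1,\dots,d}$ (this being well defined as a function of $g$ and $\bar X$), one has $$g'(g\bar X)=(g+g')\bar X$$ for all such collections $g,g'$.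
   Context: $C^\beta([0,1])$ is the space of real $\beta$-Hölder functions on $[0,1]$. $\mathcal H=T(A)$ is the real vector space spanned by all words (including the empty word $\mathbf 1$) in the alphabet $A$, with the shuffle product $⧢$, here written $x\,\mathrm{sh}\,y$, and the deconcatenation coproduct $\bar\Delta(a_1\cdots a_n)=\sum_{k=0}^n a_1\cdots a_k\otimes a_{k+1}\cdots a_n$; $\varepsilon$ is the counit. For a word $v=a_1\cdots a_k$ put $\omega(v)=\gamma_{a_1}+\dots+\gamma_{a_k}$, and let $\mathfrak L=\{v:\omega(v)\le1\}$, a finite set. Let $\mathcal H_{\mathrm a}$ be the span of $\mathfrak L$; it is a subcoalgebra, so $\mathcal H_{\mathrm a}^*$ is an algebra under $\langle\alpha\star\beta,v\rangle=\langle\alpha\otimes\beta,\bar\Delta v\rangle$ with unit $\varepsilon$. Let $\mathfrak g_{\mathrm a}$ be the set of $\alpha\in\mathcal H_{\mathrm a}^*$ with $\langle\alpha,x\,\mathrm{sh}\,y\rangle=\langle\alpha,x\rangle\langle\varepsilon,y\rangle+\langle\varepsilon,x\rangle\langle\alpha,y\rangle$ for all $x,y\in\mathcal H_{\mathrm a}$ such that $x\,\mathrm{sh}\,y\in\mathcal H_{\mathrm a}$. With $\hat\gamma=\min_i\gamma_i$ and $\hat N=\lfloor\hat\gamma^{-1}\rfloor$, let $G_{\mathrm a}=\{\sum_{k=0}^{\hat N}\frac1{k!}\alpha^{\star k}:\alpha\in\mathfrak g_{\mathrm a}\}\subset\mathcal H_{\mathrm a}^*$. An anisotropic geometric rough path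 with exponents $(\gamma_a)_{a\in A}$ is a map $X:[0,1]^2\to G_{\mathrm a}$ such that $X_{su}\star X_{ut}=X_{st}$ for all $s,u,t\in[0,1]$ and for every $v\in\mathfrak L$ there is a constant $C_v$ with $|\langle X_{st},v\rangle|\le C_v|t-s|^{\omega(v)}$ for all $s,t\in[0,1]$. *)

(* Defs.v *)
From mathcomp Require Import all_boot all_order all_algebra.
From mathcomp Require Import finmap monalg.
From mathcomp Require Import reals exp.
Set Implicit Arguments.
Unset Strict Implicit.
Unset Printing Implicit Defensive.
Import Order.TTheory GRing.Theory Num.Theory.
Local Open Scope ring_scope.

Definition unit_interval (R : realType) := {t : R | 0 <= t <= 1}.

Definition is_holder (R : realType) (beta : R) (f : unit_interval R -> R) :=
  exists C : R, forall s t,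
    `|f t - f s| <= C * `|val t - val s| `^ beta.

Definition word (d : nat) := seq 'I_d.

Definition tensor_space (R : realType) (d : nat) := {malg R[word d]}.

(* Words are listed with their multiplicity in the shuffle product. *)
Fixpoint word_shuffle (d : nat) (u : word d) : word d -> seq (word d) :=
  if u is a :: u' then
    fix shuffle_u v :=
      if v is b :: v' then
        map (cons a) (word_shuffle u' v) ++ map (cons b) (shuffle_u v')
      else [:: u]
  else fun v => [:: v].

Definition shuffle (R : realType) (d : nat) (x y : tensor_space R d) :
    tensor_space R d :=
  \sum_(u <- msupp x) \sum_(v <- msupp y) \sum_(w <- word_shuffle u v)
    << x@_u * y@_v *g w >>.

(* The pair [(v1, v2)] encodes the term [v1 \otimes v2] of the coproduct. *)
Definition deconcatenation (d : nat) (v : word d) : seq (word d * word d) :=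
  [seq (take k v, drop k v) | k <- iota 0 (size v).+1].

Definition path_collection (R : realType) (d : nat) :=
  'I_d -> unit_interval R -> R.

Definition add_collection (R : realType) (d : nat) (x y : path_collection R d) :
    path_collection R d :=
  fun i t => x i t + y i t.

Section Anisotropic.
Context {R : realType} {d : nat} (gamma : 'I_d -> R).

Definition omega (v : word d) : R := \sum_(a <- v) gamma a.

Definition light_word := {v : word d | omega v <= 1}.

Definition in_Ha (x : tensor_space R d) :=
  forall v, v \in msupp x -> omega v <= 1.

(* [Ha] is the span of [light_word] inside [tensor_space]; a linear form on it
   is given by its values on this basis. *)
Definition Ha_dual := light_word -> R.

(* The junk value 0 on words of weight > 1 is never used on [Ha]. *)
Definition word_pairing (alpha : Ha_dual) (v : word d) : R :=
  oapp alpha 0 (insub v).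

Definition pairing (alpha : Ha_dual) (x : tensor_space R d) : R :=
  \sum_(v <- msupp x) x@_v * word_pairing alpha v.

Definition counit : Ha_dual := fun v => (val v == [::])%:R.

Definition star (alpha beta : Ha_dual) : Ha_dual := fun v =>
  \sum_(p <- deconcatenation (val v))
    word_pairing alpha p.1 * word_pairing beta p.2.

Definition in_ga (alpha : Ha_dual) :=
  forall x y : tensor_space R d, in_Ha x -> in_Ha y -> in_Ha (shuffle x y) ->
    pairing alpha (shuffle x y) =
    pairing alpha x * pairing counit y + pairing counit x * pairing alpha y.

(* The exponents are < 1, so the default value 1 does not affect the minimum. *)
Definition gamma_hat : R := \big[Num.min/1]_(i < d) gamma i.

Definition N_hat : nat := Num.truncn gamma_hat^-1.

Definition exp_star (alpha : Ha_dual) : Ha_dual := fun v =>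
  \sum_(k < N_hat.+1) (k`!%:R)^-1 * iter k (star alpha) counit v.

Definition in_Ga (X : Ha_dual) := exists2 alpha, in_ga alpha & X = exp_star alpha.

Definition two_parameter_path := unit_interval R -> unit_interval R -> Ha_dual.

Definition is_rough_path (X : two_parameter_path) :=
  [/\ forall s t, in_Ga (X s t),
      forall s u t, star (X s u) (X u t) = X s t
    & forall v : light_word, exists C : R, forall s t,
        `|X s t v| <= C * `|val t - val s| `^ omega (val v)].

Definition is_holder_collection (x : path_collection R d) :=
  forall i, is_holder (gamma i) (x i).

Definition is_over (x : path_collection R d) (X : two_parameter_path) :=
  forall i s t, word_pairing (X s t) [:: i] = x i t - x i s.

End Anisotropic.

(* Main.v *)
(** The lift is built on all words, as a family of characters of the shuffle
    algebra, along the dyadic tree (in the spirit of Lyons and Victoir).  The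
    element attached to a dyadic interval is split between its two halves by
    taking its convolution square root, which is again a character, and then
    correcting the letters on both sides by the exponential of the midpoint
    defect of the path.  On a word of weight [omega < 1] the square root halves
    the value up to terms in shorter words, while the scaling to be propagated
    only asks for the factor [2^-omega > 1/2]; hence an estimate by induction on
    the length, with no further constraint on the choice.  Dyadic products then
    converge geometrically to a path [X] of characters and
    [X_s^-1 * X_t] is the rough path; nonresonance excludes weight exactly 1.
    Each character is the exponential of a primitive functional, obtained by
    recursion on the length.  Finally, the lift only uses the increments of the
    path, which are its own first level, so translation by [g] can be defined
    on lifts by adding [g] to the first level and lifting again. *)

Require Import Defs.
From mathcomp Require Import all_boot all_order all_algebra.
From mathcomp Require Import all_classical reals exp.
From mathcomp Require Import topology normedtype sequences.
From mathcomp Require finmap.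
From mathcomp Require Import -(notations) monalg.
From mathcomp Require Import ring lra zify.
Import Order.TTheory GRing.Theory Num.Theory.
Import numFieldNormedType.Exports.
Set Implicit Arguments.
Unset Strict Implicit.
Unset Printing Implicit Defensive.
Local Open Scope ring_scope.

(** * The convolution algebra of functionals on words and its compatibility with shuffles *)

Section WordAlgebra.
Context {R : numFieldType} {d : nat}.
Implicit Types (f g h X Y : word d -> R) (u v w : word d).

Lemma deconcatenation_cons (a : 'I_d) w : deconcatenation (a :: w) =
  ([::], a :: w) :: [seq (a :: p.1, p.2) | p <- deconcatenation w].
Proof.
have E : iota 0 (size (a :: w)).+1 = 0%N :: [seq k.+1 | k <- iota 0 (size w).+1].
  by rewrite -(iotaDl 1 0).
by rewrite /deconcatenation E map_cons take0 drop0 -!map_comp.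
Qed.

Lemma big_deconcatenation_cons a w (F : word d * word d -> R) :
  \sum_(p <- deconcatenation (a :: w)) F p =
  F ([::], a :: w) + \sum_(p <- deconcatenation w) F (a :: p.1, p.2).
Proof. by rewrite deconcatenation_cons big_cons big_map. Qed.

Lemma mem_deconcatenation w p : p \in deconcatenation w -> p.1 ++ p.2 = w.
Proof. by case/mapP => k _ ->; rewrite cat_take_drop. Qed.

(** The analogue of [star] on all words; no truncation by weight intervenes until functionals are
    restricted to [Ha_dual]. *)
Definition conv f g : word d -> R :=
  fun w => \sum_(p <- deconcatenation w) f p.1 * g p.2.

Definition unitw : word d -> R := fun w => (w == [::])%:R.

Lemma conv_nil f g : conv f g [::] = f [::] * g [::].
Proof. by rewrite /conv big_seq1. Qed.

Lemma conv_cons f g a w :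
  conv f g (a :: w) = f [::] * g (a :: w) + conv (fun u => f (a :: u)) g w.
Proof. by rewrite /conv deconcatenation_cons big_cons big_map. Qed.

Lemma conv_letter f g a : conv f g [:: a] = f [::] * g [:: a] + f [:: a] * g [::].
Proof. by rewrite conv_cons conv_nil. Qed.

Lemma convDl f f' g w : conv (fun u => f u + f' u) g w = conv f g w + conv f' g w.
Proof. by rewrite /conv -big_split; apply: eq_bigr => p _; rewrite mulrDl. Qed.

Lemma convDr f g g' w : conv f (fun u => g u + g' u) w = conv f g w + conv f g' w.
Proof. by rewrite /conv -big_split; apply: eq_bigr => p _; rewrite mulrDr. Qed.

Lemma convZl c f g w : conv (fun u => c * f u) g w = c * conv f g w.
Proof. by rewrite /conv mulr_sumr; apply: eq_bigr => p _; rewrite mulrA. Qed.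

Lemma convZr c f g w : conv f (fun u => c * g u) w = c * conv f g w.
Proof. by rewrite /conv mulr_sumr; apply: eq_bigr => p _; rewrite mulrCA. Qed.

Lemma convA f g h : conv (conv f g) h = conv f (conv g h).
Proof.
apply/funext => w; elim: w f g => [|a w IH] f g; first by rewrite !conv_nil mulrA.
have -> : conv (conv f g) h (a :: w) =
    f [::] * g [::] * h (a :: w) +
    conv (fun u => f [::] * g (a :: u) + conv (fun u => f (a :: u)) g u) h w.
  rewrite conv_cons conv_nil; congr (_ + _).
  by apply: eq_bigr => p _; rewrite conv_cons.
by rewrite convDl convZl IH !conv_cons mulrDr mulrA addrA.
Qed.

Lemma big_deconcatenation_first (F : word d * word d -> R) w :
  (forall p, p \in deconcatenation w -> p.1 != [::] -> F p = 0) ->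
  \sum_(p <- deconcatenation w) F p = F ([::], w).
Proof.
case: w => [|a w]; first by rewrite big_seq1.
rewrite deconcatenation_cons big_cons => F0; rewrite big1_seq ?addr0 // => p /andP[_ pw].
by apply: F0; [rewrite inE pw orbT | case/mapP: pw => q _ ->].
Qed.

Lemma big_deconcatenation_last (F : word d * word d -> R) w :
  (forall p, p \in deconcatenation w -> p.2 != [::] -> F p = 0) ->
  \sum_(p <- deconcatenation w) F p = F (w, [::]).
Proof.
elim: w F => [|a w IH] F; first by rewrite big_seq1.
rewrite deconcatenation_cons big_cons => F0; rewrite F0 ?inE ?eqxx // add0r big_map.
rewrite (IH (fun p => F (a :: p.1, p.2))) // => p pw p2; apply: F0 => //.
by rewrite inE; apply/orP; right; apply/mapP; exists p.
Qed.

Lemma conv1f f : conv unitw f = f.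
Proof.
apply/funext => w; rewrite /conv big_deconcatenation_first /unitw ?mul1r // => p _.
by move=> /negPf ->; rewrite mul0r.
Qed.

Lemma convf1 f : conv f unitw = f.
Proof.
apply/funext => w; rewrite /conv big_deconcatenation_last /unitw ?mulr1 // => p _.
by move=> /negPf ->; rewrite mulr0.
Qed.

Definition reduced f : word d -> R := fun w => if w is [::] then 0 else f w.

(** Only splits into two nonempty pieces survive, so the value at [w] depends on strictly shorter
    words; this is the remainder term in the recursions on length. *)
Definition pconv f g := conv (reduced f) (reduced g).

Lemma reducedE f : f [::] = 1 -> f = fun w => unitw w + reduced f w.
Proof. by move=> f1; apply/funext => -[|a w] /=; rewrite /unitw ?f1 ?addr0 ?add0r. Qed.

Lemma conv_pconv f g w : f [::] = 1 -> g [::] = 1 -> w != [::] ->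
  conv f g w = f w + g w + pconv f g w.
Proof.
move=> f1 g1 w0; rewrite [in LHS](reducedE f1) [in LHS](reducedE g1).
rewrite convDl !convDr !conv1f convf1.
by case: w w0 => [//|a w _]; rewrite /pconv {1}/unitw /= add0r addrCA addrA.
Qed.

Lemma size_deconcatenation w p : p \in deconcatenation w ->
  (size p.1 + size p.2)%N = size w.
Proof. by move/mem_deconcatenation <-; rewrite size_cat. Qed.

Lemma proper_deconcatenation w p : p \in deconcatenation w ->
  p.1 != [::] -> p.2 != [::] -> (size p.1 < size w)%N /\ (size p.2 < size w)%N.
Proof. by move/size_deconcatenation <-; rewrite -!size_eq0 => *; split; lia. Qed.

Lemma eq_pconv f f' g g' w :
  (forall u, (size u < size w)%N -> f u = f' u) ->
  (forall u, (size u < size w)%N -> g u = g' u) -> pconv f g w = pconv f' g' w.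
Proof.
move=> ff gg; apply: eq_big_seq => -[[|a u] [|b v]] /=; rewrite /= ?mul0r ?mulr0 //.
by move=> /proper_deconcatenation[] // us vs; rewrite ff ?gg.
Qed.

Lemma size_fst_le w p : p \in deconcatenation w -> (size p.1 <= size w)%N.
Proof. by move/size_deconcatenation <-; rewrite leq_addr. Qed.

Lemma size_snd_le w p : p \in deconcatenation w -> (size p.2 <= size w)%N.
Proof. by move/size_deconcatenation <-; rewrite leq_addl. Qed.

Lemma size_fst_lt w p : p \in deconcatenation w -> p.2 != [::] ->
  (size p.1 < size w)%N.
Proof.
move=> pw; rewrite -size_eq0 -lt0n -(size_deconcatenation pw) => p0.
by rewrite -[X in (X < _)%N]addn0 ltn_add2l.
Qed.

Lemma size_snd_lt w p : p \in deconcatenation w -> p.1 != [::] ->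
  (size p.2 < size w)%N.
Proof.
move=> pw; rewrite -size_eq0 -lt0n -(size_deconcatenation pw) => p0.
by rewrite -[X in (X < _)%N]add0n ltn_add2r.
Qed.

(** Recursion on word length by iteration from zero: if [Phi f w] looks at [f] on shorter words
    only, the iterates are stationary at [w] after [(size w).+1] rounds. *)
Definition recw (Phi : (word d -> R) -> word d -> R) : word d -> R :=
  fun w => iter (size w).+1 Phi (fun=> 0) w.

Lemma recwE Phi :
  (forall f g w, (forall u, (size u < size w)%N -> f u = g u) -> Phi f w = Phi g w) ->
  forall w, recw Phi w = Phi (recw Phi) w.
Proof.
move=> loc.
have iterE n m w : (size w < n)%N -> (size w < m)%N ->
    iter n Phi (fun=> 0) w = iter m Phi (fun=> 0) w.
  elim: n m w => [//|n IH] [//|m] w wn wm; rewrite !iterS; apply: loc => u uw.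
  by apply: IH; lia.
by move=> w; rewrite {1}/recw iterS; apply: loc => u uw; apply: iterE.
Qed.

(** If [Y] is 1 on the empty word, then [conv Y Y w = 2 * Y w + pconv Y Y w] for nonempty [w];
    solving for [Y w] gives the recursion. *)
Definition wroot X := recw (fun Y w =>
  if w is [::] then 1 else (X w - pconv Y Y w) / 2).

Lemma wrootE X w : wroot X w =
  if w is [::] then 1 else (X w - pconv (wroot X) (wroot X) w) / 2.
Proof.
by rewrite /wroot recwE // => f g [//|a v] fg; rewrite (eq_pconv fg fg).
Qed.

Lemma conv_wroot X : X [::] = 1 -> conv (wroot X) (wroot X) = X.
Proof.
move=> X1; apply/funext => -[|a w]; first by rewrite conv_nil !wrootE X1 mulr1.
by rewrite conv_pconv ?wrootE //; field.
Qed.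

Definition winv X := recw (fun Y w =>
  if w is [::] then 1 else - X w - pconv Y X w).

Lemma winvE X w : winv X w =
  if w is [::] then 1 else - X w - pconv (winv X) X w.
Proof.
by rewrite /winv recwE // => f g [//|a v] fg; rewrite (@eq_pconv f g X X).
Qed.

Lemma winv_nil X : winv X [::] = 1. Proof. by rewrite winvE. Qed.

Lemma conv_winvl X : X [::] = 1 -> conv (winv X) X = unitw.
Proof.
move=> X1; apply/funext => -[|a w]; first by rewrite conv_nil winv_nil X1 mulr1.
by rewrite conv_pconv ?winvE // /unitw /=; ring.
Qed.

(** Associate the product of [winv (winv X)], [winv X] and [X] in two ways. This makes the left
    inverse two-sided. *)
Lemma winvK X : X [::] = 1 -> winv (winv X) = X.
Proof.
by move=> X1; rewrite -[LHS]convf1 -(conv_winvl X1) -convA conv_winvl ?conv1f.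
Qed.

Lemma conv_winvr X : X [::] = 1 -> conv X (winv X) = unitw.
Proof. by move=> X1; rewrite -{1}(winvK X1) conv_winvl // winv_nil. Qed.

Lemma convKl X f : X [::] = 1 -> conv (winv X) (conv X f) = f.
Proof. by move=> X1; rewrite -convA conv_winvl ?conv1f. Qed.

Lemma convKr X f : X [::] = 1 -> conv X (conv (winv X) f) = f.
Proof. by move=> X1; rewrite -convA conv_winvr ?conv1f. Qed.

Lemma winv_conv X Y : X [::] = 1 -> Y [::] = 1 ->
  winv (conv X Y) = conv (winv Y) (winv X).
Proof.
move=> X1 Y1; have XY1 : conv X Y [::] = 1 by rewrite conv_nil X1 Y1 mulr1.
have inv : conv (conv (winv Y) (winv X)) (conv X Y) = unitw.
  by rewrite convA convKl // conv_winvl.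
by rewrite -[LHS]conv1f -inv convA conv_winvr // convf1.
Qed.

Definition shuffle_sum f u v := \sum_(w <- word_shuffle u v) f w.

Lemma word_shuffle_nil u : word_shuffle u [::] = [:: u].
Proof. by case: u. Qed.

Lemma shuffle_sum_nill f v : shuffle_sum f [::] v = f v.
Proof. by rewrite /shuffle_sum big_seq1. Qed.

Lemma shuffle_sum_nilr f u : shuffle_sum f u [::] = f u.
Proof. by rewrite /shuffle_sum word_shuffle_nil big_seq1. Qed.

Lemma shuffle_sum_cons f a u b v : shuffle_sum f (a :: u) (b :: v) =
  shuffle_sum (fun w => f (a :: w)) u (b :: v) +
  shuffle_sum (fun w => f (b :: w)) (a :: u) v.
Proof. by rewrite /shuffle_sum big_cat !big_map. Qed.

Implicit Types Phi Psi Theta Delta : word d -> word d -> R.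

Definition conv2 Phi Psi u v := \sum_(p <- deconcatenation u)
  \sum_(q <- deconcatenation v) Phi p.1 q.1 * Psi p.2 q.2.

(** Bialgebra compatibility: deconcatenation is multiplicative for the shuffle product. A double
    induction peels off first letters, separating the splits with an empty left piece. *)
Lemma shuffle_sum_conv f g u v :
  shuffle_sum (conv f g) u v = conv2 (shuffle_sum f) (shuffle_sum g) u v.
Proof.
elim: u v f => [|a u IHu] v f.
  rewrite shuffle_sum_nill /conv2 big_seq1; apply: eq_bigr => q _.
  by rewrite !shuffle_sum_nill.
elim: v f => [|b v IHv] f.
  rewrite shuffle_sum_nilr /conv2; apply: eq_bigr => p _.
  by rewrite big_seq1 !shuffle_sum_nilr.
have shE c w w' : shuffle_sum (fun u => conv f g (c :: u)) w w' =
    f [::] * shuffle_sum (fun u => g (c :: u)) w w' +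
    shuffle_sum (conv (fun u => f (c :: u)) g) w w'.
  rewrite /shuffle_sum mulr_sumr -big_split; apply: eq_bigr => z _.
  exact: conv_cons.
rewrite shuffle_sum_cons !shE IHu IHv addrACA -mulrDr -shuffle_sum_cons.
rewrite /conv2 !(big_deconcatenation_cons a) /=.
rewrite !(big_deconcatenation_cons b) /= shuffle_sum_nill -!addrA.
congr (_ + _); rewrite addrCA; congr (_ + _).
  by apply: eq_bigr => q _; rewrite !shuffle_sum_nill.
rewrite -big_split; apply: eq_bigr => p _ /=.
rewrite !big_deconcatenation_cons /= !shuffle_sum_nilr -addrA -big_split.
congr (_ + _); apply: eq_bigr => q _ /=.
by rewrite shuffle_sum_cons mulrDl.
Qed.
End WordAlgebra.
Lemma word_size_ind d (P : word d -> Prop) :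
  (forall w, (forall u, (size u < size w)%N -> P u) -> P w) -> forall w, P w.
Proof.
move=> IH w; have [n] := ubnP (size w); elim: n w => [//|n IHn] w.
by rewrite ltnS => wn; apply: IH => u uw; apply: IHn; apply: leq_trans uw wn.
Qed.

(** * Characters of the shuffle algebra *)

Section Characters.
Context {R : numFieldType} {d : nat}.
Implicit Types (f g X Y a : word d -> R) (u v w : word d).
Implicit Types Phi Psi Theta Delta : word d -> word d -> R.

Lemma size_word_shuffle u v :
  size (word_shuffle u v) = 'C(size u + size v, size u).
Proof.
elim: u v => [|a u IHu] v; first by rewrite bin0.
elim: v => [|b v IHv]; first by rewrite addn0 binn.
rewrite /= size_cat !size_map IHu (IHv : size (_ v) = _) /= !addSn binS addnC.
by rewrite addnS.
Qed.

Lemma perm_word_shuffle u v w : w \in word_shuffle u v -> perm_eq w (u ++ v).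
Proof.
elim: u v w => [|a u IHu] v w; first by rewrite inE => /eqP ->.
elim: v w => [|b v IHv] w; first by rewrite inE cats0 => /eqP ->.
rewrite mem_cat => /orP[] /mapP[w' w'uv ->].
  by rewrite /= perm_cons; apply: IHu.
have /perm_trans -> // : perm_eq (b :: w') (b :: (a :: u) ++ v).
  by rewrite perm_cons; apply: IHv.
by rewrite perm_sym -[(a :: u) ++ b :: v]/((a :: u) ++ [:: b] ++ v) perm_catCA.
Qed.

Lemma eq_conv2 Phi Phi' Psi Psi' u v :
  (forall u' v', Phi u' v' = Phi' u' v') -> (forall u' v', Psi u' v' = Psi' u' v') ->
  conv2 Phi Psi u v = conv2 Phi' Psi' u v.
Proof. by move=> E E'; apply: eq_bigr => p _; apply: eq_bigr => q _; rewrite E E'. Qed.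

Lemma conv2_tensor f f' g g' u v :
  conv2 (fun u v => f u * f' v) (fun u v => g u * g' v) u v =
  conv f g u * conv f' g' v.
Proof.
rewrite /conv2 /conv mulr_suml; apply: eq_bigr => p _.
by rewrite mulr_sumr; apply: eq_bigr => q _; rewrite mulrACA.
Qed.

(** Leading-term extraction: [Delta] only sees the split that hands it both words whole. *)
Lemma conv2_lowl Delta Psi u v :
  (forall u' v', (size u' + size v' < size u + size v)%N -> Delta u' v' = 0) ->
  conv2 Delta Psi u v = Delta u v * Psi [::] [::].
Proof.
move=> D0; rewrite /conv2 big_deconcatenation_last => [|p pu p2].
  apply: (big_deconcatenation_last (F := fun q => _ q.1 * _ q.2)) => q qv q2.
  by rewrite D0 ?mul0r // ltn_add2l (size_fst_lt qv).
rewrite big1_seq // => q /andP[_ qv].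
by rewrite D0 ?mul0r // -addSn leq_add ?(size_fst_lt pu) ?(size_fst_le qv).
Qed.

Lemma conv2_lowr Delta Psi u v :
  (forall u' v', (size u' + size v' < size u + size v)%N -> Delta u' v' = 0) ->
  conv2 Psi Delta u v = Psi [::] [::] * Delta u v.
Proof.
move=> D0; rewrite /conv2 big_deconcatenation_first => [|p pu p2].
  apply: (big_deconcatenation_first (F := fun q => _ q.1 * _ q.2)) => q qv q2.
  by rewrite D0 ?mulr0 // ltn_add2l (size_snd_lt qv).
rewrite big1_seq // => q /andP[_ qv].
by rewrite D0 ?mulr0 // -addSn leq_add ?(size_snd_lt pu) ?(size_snd_le qv).
Qed.

Lemma size2_ind (P : word d -> word d -> Prop) :
  (forall u v, (forall u' v',
    (size u' + size v' < size u + size v)%N -> P u' v') -> P u v) ->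
  forall u v, P u v.
Proof.
move=> IH u v; have [n] := ubnP (size u + size v)%N.
elim: n u v => [|n IHn] u v; first by rewrite ltn0.
by rewrite ltnS => uvn; apply: IH => u' v' lt'; apply: IHn; apply: leq_trans uvn.
Qed.

Lemma conv2_subl Phi Phi' Psi u v :
  conv2 (fun u v => Phi u v - Phi' u v) Psi u v =
  conv2 Phi Psi u v - conv2 Phi' Psi u v.
Proof.
rewrite /conv2 -sumrB; apply: eq_bigr => p _.
by rewrite -sumrB; apply: eq_bigr => q _; rewrite mulrBl.
Qed.

Lemma conv2_subr Phi Psi Psi' u v :
  conv2 Phi (fun u v => Psi u v - Psi' u v) u v =
  conv2 Phi Psi u v - conv2 Phi Psi' u v.
Proof.
rewrite /conv2 -sumrB; apply: eq_bigr => p _.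
by rewrite -sumrB; apply: eq_bigr => q _; rewrite mulrBr.
Qed.

(** By induction on the total length the difference vanishes on shorter pairs, so convolving it with
    [Psi] returns the difference itself. *)
Lemma conv2_cancel Phi Phi' Psi : Psi [::] [::] = 1 ->
  (forall u v, conv2 Phi Psi u v = conv2 Phi' Psi u v) ->
  forall u v, Phi u v = Phi' u v.
Proof.
move=> Psi1 E; apply: size2_ind => u v IH; apply/eqP; rewrite -subr_eq0; apply/eqP.
rewrite -[LHS]mulr1 -Psi1.
rewrite -(@conv2_lowl (fun u v => Phi u v - Phi' u v)) => [|u' v' /IH ->].
  by rewrite conv2_subl E subrr.
by rewrite subrr.
Qed.

(** The difference of the two squares has twice the difference of the roots as its leading term, and
    2 is invertible. *)
Lemma conv2_square_inj Phi Psi : Phi [::] [::] = 1 -> Psi [::] [::] = 1 ->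
  (forall u v, conv2 Phi Phi u v = conv2 Psi Psi u v) ->
  forall u v, Phi u v = Psi u v.
Proof.
move=> Phi1 Psi1 E; apply: size2_ind => u v IH.
have D0 u' v' : (size u' + size v' < size u + size v)%N -> Phi u' v' - Psi u' v' = 0.
  by move=> /IH ->; rewrite subrr.
(* With [x] and [y] as named just below, the difference at [(u, v)] equals both [x - y] and [y - x],
   so it is zero. *)
have := conv2_lowl Phi D0; have := conv2_lowr Psi D0.
rewrite conv2_subl conv2_subr E Phi1 Psi1 mul1r mulr1 => <- /eqP.
set x := conv2 Psi Phi u v; set y := conv2 Psi Psi u v => /eqP xy.
have {xy} : 2 * (x - y) = 0 by rewrite mulr2n mulrDl mul1r -{2}xy; ring.
move=> /eqP; rewrite mulf_eq0 pnatr_eq0 /= => /eqP xy0.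
have := conv2_lowr Psi D0; rewrite conv2_subr -/x -/y xy0 Psi1 mul1r => /esym/eqP.
by rewrite subr_eq0 => /eqP.
Qed.

Definition is_character X :=
  X [::] = 1 /\ forall u v, shuffle_sum X u v = X u * X v.

Lemma conv_character X Y :
  is_character X -> is_character Y -> is_character (conv X Y).
Proof.
move=> [X1 sX] [Y1 sY]; split=> [|u v]; first by rewrite conv_nil X1 Y1 mulr1.
by rewrite shuffle_sum_conv (eq_conv2 _ _ sX sY) conv2_tensor.
Qed.

Lemma unitw_character : is_character unitw.
Proof.
split=> [|u v]; first by rewrite /unitw eqxx.
case: u => [|a u]; first by rewrite shuffle_sum_nill /unitw mul1r.
case: v => [|b v]; first by rewrite shuffle_sum_nilr /unitw mulr1.
by rewrite shuffle_sum_cons /shuffle_sum !big1 ?addr0 ?mul0r.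
Qed.

(** The shuffle of the root and the tensor square of the root are two square roots of the same
    functional on pairs, hence equal. *)
Lemma wroot_character X : is_character X -> is_character (wroot X).
Proof.
move=> [X1 sX]; split=> [|u v]; first by rewrite wrootE.
apply: (@conv2_square_inj _ (fun u v => wroot X u * wroot X v)) => [||u' v'].
- by rewrite shuffle_sum_nill wrootE.
- by rewrite wrootE mulr1.
by rewrite -shuffle_sum_conv conv2_tensor conv_wroot.
Qed.

(** Both candidates are left inverses of [shuffle_sum X] on pairs, so cancellation identifies
    them. *)
Lemma winv_character X : is_character X -> is_character (winv X).
Proof.
move=> [X1 sX]; split=> [|u v]; first by rewrite winv_nil.
apply: (@conv2_cancel _ (fun u v => winv X u * winv X v) (shuffle_sum X)).
  by rewrite shuffle_sum_nill.
move=> u' v'; rewrite -shuffle_sum_conv (eq_conv2 _ _ (fun _ _ => erefl) sX).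
rewrite conv2_tensor conv_winvl //; have [_ ->] := unitw_character; by [].
Qed.

(** The signature of a straight segment with increment [h], that is, the exponential of [h] placed
    on letters. *)
Definition letter_exp (h : 'I_d -> R) : word d -> R :=
  fun w => (\prod_(a <- w) h a) / (size w)`!%:R.

(** The value is invariant under permuting letters, so a shuffle contributes one value times the
    binomial number of shuffles. *)
Lemma letter_exp_character h : is_character (letter_exp h).
Proof.
split=> [|u v]; first by rewrite /letter_exp big_nil divr1.
rewrite /shuffle_sum big_seq.
rewrite (eq_bigr (fun=> letter_exp h (u ++ v))); last first.
  move=> w /perm_word_shuffle wuv; rewrite /letter_exp (perm_size wuv).
  by rewrite (perm_big _ wuv).
rewrite -big_seq big_const_seq count_predT iter_addr_0 size_word_shuffle.
rewrite /letter_exp big_cat size_cat /= -mulr_natr.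
have := bin_fact (leq_addr (size v) (size u)); rewrite addKn => <-.
have F n : n`!%:R != 0 :> R by rewrite pnatr_eq0 -lt0n fact_gt0.
have C : 'C(size u + size v, size u)%:R != 0 :> R.
  by rewrite pnatr_eq0 -lt0n bin_gt0 leq_addr.
by rewrite !natrM; field; rewrite !F C.
Qed.

(** * Exponentials of primitive functionals *)

Definition wpow a k : word d -> R := iter k (conv a) unitw.

Definition wexp_upto n a : word d -> R :=
  fun w => \sum_(k < n.+1) (k`!%:R)^-1 * wpow a k w.

Definition is_primitive a := forall u v,
  shuffle_sum a u v = a u * unitw v + unitw u * a v.

Lemma primitive_nil a : is_primitive a -> a [::] = 0.
Proof.
move=> /(_ [::] [::]); rewrite shuffle_sum_nill /unitw eqxx mulr1 mul1r => /eqP.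
by rewrite -subr_eq0 opprD addrA subrr sub0r oppr_eq0 => /eqP.
Qed.

Lemma wpow_gt_size a k w : a [::] = 0 -> (size w < k)%N -> wpow a k w = 0.
Proof.
move=> a0; elim: k w => [//|k IH] w wk; rewrite /wpow iterS; apply: big1_seq => p.
move=> /andP[_ pw]; have [->|p1] := eqVneq p.1 [::]; first by rewrite a0 mul0r.
by rewrite [iter _ _ _ _]IH ?mulr0 //; apply: leq_trans (size_snd_lt pw p1) wk.
Qed.

Lemma eq_wpow a a' k w : (forall u, (size u <= size w)%N -> a u = a' u) ->
  wpow a k w = wpow a' k w.
Proof.
elim: k w => [//|k IH] w E; rewrite /wpow !iterS; apply: eq_big_seq => p pw.
rewrite E ?(size_fst_le pw) //; congr (_ * _); apply: IH => u us.
by apply: E; apply: leq_trans us (size_snd_le pw).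
Qed.

(** With at least two factors, each vanishing on the empty word, no factor ever receives the whole
    of [w]. *)
Lemma eq_wpow_lt a a' k w : (1 < k)%N -> a [::] = 0 -> a' [::] = 0 ->
  (forall u, (size u < size w)%N -> a u = a' u) -> wpow a k w = wpow a' k w.
Proof.
case: k => [|[|k]] // _ a0 a0' E.
change (conv a (wpow a k.+1) w = conv a' (wpow a' k.+1) w).
apply: eq_big_seq => -[[|b u] [|c v]] pw /=; rewrite ?a0 ?a0' ?mul0r //.
  by rewrite !conv_nil a0 a0' !mul0r !mulr0.
have [] // := proper_deconcatenation pw => us vs; rewrite E //.
congr (_ * _); apply: (@eq_wpow a a' k.+1) => z zs.
by apply: E; apply: leq_ltn_trans zs vs.
Qed.

Lemma wexp_upto_size a n w : a [::] = 0 -> (size w <= n)%N ->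
  wexp_upto n a w = wexp_upto (size w) a w.
Proof.
move=> a0 wn; rewrite /wexp_upto (big_ord_widen _ (fun k => (k`!%:R)^-1 * wpow a k w)
  (wn : (size w).+1 <= n.+1)%N).
rewrite [LHS](bigID (fun k : 'I_n.+1 => k < (size w).+1)%N) /= [X in _ + X]big1 ?addr0 //.
by move=> k; rewrite -leqNgt => kw; rewrite wpow_gt_size ?mulr0.
Qed.

(** Pascal's rule in summed form: the step from power [k] to [k.+1] in the binomial formula. *)
Lemma leibniz_sum (A B : nat -> R) k :
  \sum_(i < k.+1) 'C(k, i)%:R * (A i.+1 * B (k - i)%N + A i * B (k - i).+1) =
  \sum_(i < k.+2) 'C(k.+1, i)%:R * (A i * B (k.+1 - i)%N).
Proof.
pose f i := A i * B (k.+1 - i)%N.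
have fE : \sum_(i < k.+1) 'C(k, i)%:R * f i =
    f 0%N + \sum_(i < k.+1) 'C(k, i.+1)%:R * f i.+1.
  rewrite big_ord_recl bin0 mul1r [in RHS]big_ord_recr /= bin_small // mul0r addr0.
  by congr (_ + _); apply: eq_bigr => i _.
transitivity (\sum_(i < k.+1) ('C(k, i)%:R * f i.+1 + 'C(k, i)%:R * f i)).
  by apply: eq_bigr => i _; rewrite /f subSS -subSn ?mulrDr // -ltnS.
rewrite big_split /= fE addrCA -big_split /= [RHS]big_ord_recl bin0 mul1r.
congr (_ + _); apply: eq_bigr => i _ /=.
by rewrite /bump leq0n add1n binS natrD mulrDl addrC.
Qed.

(** Used to multiply two truncated exponentials: summing along antidiagonals loses nothing when
    terms beyond the diagonal [n] vanish. *)
Lemma sum_triangle n (F : nat -> nat -> R) :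
  (forall i j, (n < i + j)%N -> F i j = 0) ->
  \sum_(k < n.+1) \sum_(i < k.+1) F i (k - i)%N = \sum_(i < n.+1) \sum_(j < n.+1) F i j.
Proof.
move=> F0.
transitivity (\sum_(k < n.+1) \sum_(i < n.+1 | (i < k.+1)%N) F i (k - i)%N).
  by apply: eq_bigr => k _; rewrite (big_ord_widen _ (fun i => F i (k - i)%N) (ltn_ord k)).
rewrite (exchange_big_dep predT) //=; apply: eq_bigr => i _.
rewrite -(big_mkord (fun k => (i < k.+1)%N) (fun k => F i (k - i)%N)).
rewrite -(big_mkord predT (F i)) (big_cat_nat _ (n := i)) //= 1?ltnW //.
rewrite big_nat_cond big_pred0 ?add0r; last by move=> k; apply/negP; lia.
rewrite -{1}[val i]add0n big_addn [RHS](big_cat_nat _ (n := n.+1 - i)%N) ?leq_subr //=.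
rewrite [X in _ = _ + X]big_nat_cond [X in _ = _ + X]big1 ?addr0; last first.
  by move=> j /andP[/andP[jn _] _]; apply: F0; lia.
by apply: eq_big => [k|k _]; rewrite ?addnK // ltnS leq_addl.
Qed.

(** On pairs, a primitive [a] is the sum of its actions on each factor; these commute, so powers
    expand by the binomial theorem. *)
Lemma shuffle_sum_wpow a k u v : is_primitive a -> shuffle_sum (wpow a k) u v =
  \sum_(i < k.+1) 'C(k, i)%:R * (wpow a i u * wpow a (k - i) v).
Proof.
move=> pa; elim: k u v => [|k IH] u v.
  by rewrite big_ord1 /= mul1r; have [_ ->] := unitw_character.
rewrite [wpow a k.+1]/(conv a (wpow a k)) shuffle_sum_conv.
pose S f g i := conv f (wpow a i) u * conv g (wpow a (k - i)) v.
transitivity (\sum_(i < k.+1) 'C(k, i)%:R * (S a unitw i + S unitw a i)).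
  rewrite (eq_conv2 _ _ pa IH) /conv2.
  under eq_bigr do under eq_bigr do rewrite mulr_sumr.
  under eq_bigr do rewrite exchange_big /=.
  rewrite exchange_big; apply: eq_bigr => i _ /=.
  rewrite /S -!conv2_tensor /conv2 -big_split mulr_sumr; apply: eq_bigr => p _ /=.
  by rewrite -big_split mulr_sumr; apply: eq_bigr => q _ /=; ring.
rewrite -(@leibniz_sum (fun i => wpow a i u) (fun i => wpow a i v)).
by apply: eq_bigr => i _; rewrite /S !conv1f.
Qed.

(** For [a] vanishing on the empty word this is the full exponential series, since powers above the
    length of [w] vanish there. *)
Definition wexp a : word d -> R := fun w => wexp_upto (size w) a w.

Lemma wexp_character a : is_primitive a -> is_character (wexp a).
Proof.
move=> pa; have a0 := primitive_nil pa.
split=> [|u v]; first by rewrite /wexp /wexp_upto big_ord1 /= invr1 mul1r.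
pose n := (size u + size v)%N.
transitivity (shuffle_sum (wexp_upto n a) u v).
  apply: eq_big_seq => w /perm_word_shuffle/perm_size.
  by rewrite size_cat /wexp /n => ->.
rewrite /wexp -(@wexp_upto_size a n u) ?leq_addr // -(@wexp_upto_size a n v) ?leq_addl //.
pose F i j := (i`!%:R)^-1 * wpow a i u * ((j`!%:R)^-1 * wpow a j v).
transitivity (\sum_(k < n.+1) \sum_(i < k.+1) F i (k - i)%N).
  rewrite /shuffle_sum /wexp_upto exchange_big; apply: eq_bigr => k _ /=.
  rewrite -mulr_sumr [X in _ * X](shuffle_sum_wpow k u v pa) mulr_sumr.
  apply: eq_bigr => i _; rewrite /F.
  have := bin_fact (ltn_ord i : i <= k)%N => <-.
  have fn m : m`!%:R != 0 :> R by rewrite pnatr_eq0 -lt0n fact_gt0.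
  have C : 'C(k, i)%:R != 0 :> R by rewrite pnatr_eq0 -lt0n bin_gt0 -ltnS.
  by rewrite !natrM; field; rewrite !fn C.
rewrite sum_triangle => [|i j ij]; last first.
  have [iu|iu] := ltnP (size u) i; first by rewrite /F wpow_gt_size // mulr0 mul0r.
  by rewrite /F [wpow a j v]wpow_gt_size ?mulr0 //; move: ij; rewrite /n; lia.
by rewrite /wexp_upto mulr_suml; apply: eq_bigr => i _; rewrite mulr_sumr.
Qed.

(** * Logarithms of characters *)

Definition truncw n a : word d -> R := fun w => if (size w < n)%N then a w else 0.

(** The exponential at a nonempty [w] is [a w] plus a quantity determined by shorter words, so [a w]
    can be solved for. *)
Definition wlog X := recw (fun a w => X w - wexp (truncw (size w) a) w).

Lemma wlogE X w : wlog X w = X w - wexp (truncw (size w) (wlog X)) w.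
Proof.
rewrite /wlog recwE // => f g v fg; congr (_ - wexp _ _).
by apply/funext => u; rewrite /truncw; case: ifP => // /fg.
Qed.

Lemma wexp_truncw a w : a [::] = 0 -> w != [::] ->
  wexp a w = a w + wexp (truncw (size w) a) w.
Proof.
move=> a0 w0; rewrite /wexp /wexp_upto; case s: (size w) => [|n].
  by move: s w0 => /eqP; rewrite size_eq0 => ->.
rewrite big_ord_recl [in LHS]big_ord_recl [in RHS]big_ord_recl [in RHS]big_ord_recl /=.
rewrite !convf1 {1}/truncw s ltnn mulr0 add0r addrCA /bump /= invr1 mul1r.
congr (_ + (_ + _)); apply: eq_bigr => i _; congr (_ * _).
apply: (@eq_wpow_lt a _ i.+2) => //.
by move=> u; rewrite /truncw s => ->.
Qed.

Lemma wlog_nil X : X [::] = 1 -> wlog X [::] = 0.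
Proof. by move=> X1; rewrite wlogE X1 /wexp /wexp_upto big_ord1 /= invr1 mul1r subrr. Qed.

Lemma wexp_wlog X : X [::] = 1 -> wexp (wlog X) = X.
Proof.
move=> X1; apply/funext => w; have [->|w0] := eqVneq w [::].
  by rewrite X1 /wexp /wexp_upto big_ord1 /= invr1 mul1r.
by rewrite wexp_truncw ?wlog_nil // {1}wlogE subrK.
Qed.

(** Truncate the logarithm below the total length [n]. Its exponential is a character agreeing with
    [X] on words shorter than [n]; subtracting the two shuffle identities at nonempty [u], [v] gives
    zero. *)
Lemma wlog_primitive X : is_character X -> is_primitive (wlog X).
Proof.
move=> [X1 sX]; apply: size2_ind => u v IH; have a0 := wlog_nil X1.
have [->|u0] := eqVneq u [::].
  by rewrite shuffle_sum_nill a0 mul0r add0r /unitw mul1r.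
have [->|v0] := eqVneq v [::].
  by rewrite shuffle_sum_nilr a0 mulr0 addr0 /unitw mulr1.
rewrite /unitw (negPf u0) (negPf v0) mulr0 mul0r addr0.
set a := wlog X in IH a0 *; set n := (size u + size v)%N in IH.
(* Below total length [n] this is the induction hypothesis; from [n] on both sides vanish. *)
have pb : is_primitive (truncw n a).
  move=> u' v'; have [uv|uv] := ltnP (size u' + size v') n; rewrite /truncw.
    have [-> ->] : (size u' < n)%N /\ (size v' < n)%N by lia.
    rewrite -IH //; apply: eq_big_seq => w /perm_word_shuffle/perm_size.
    by rewrite size_cat => ->; rewrite uv.
  rewrite /shuffle_sum big_seq big1 => [|w /perm_word_shuffle/perm_size]; last first.
    by rewrite size_cat ltnNge => ->; rewrite uv.
  have z0 (x y : word d) : (n <= size x + size y)%N ->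
      (if (size x < n)%N then a x else 0) * unitw y = 0.
    case: y => [|c y]; last by rewrite /unitw mulr0.
    by rewrite addn0 ltnNge => ->; rewrite mul0r.
  by rewrite z0 // mulrC z0 ?addr0 // addnC.
have [_ sE] := wexp_character pb.
have EX w : (size w < n)%N -> wexp (truncw n a) w = X w.
  move=> wn; rewrite -[in RHS](wexp_wlog X1) /wexp /wexp_upto -/a.
  apply: eq_bigr => k _; congr (_ * _); apply: eq_wpow => z zw.
  by rewrite /truncw (leq_ltn_trans zw).
transitivity (shuffle_sum X u v - shuffle_sum (wexp (truncw n a)) u v).
  rewrite /shuffle_sum -sumrB; apply: eq_big_seq => w /perm_word_shuffle/perm_size.
  by rewrite size_cat /a wlogE => ->.
rewrite sX sE !EX ?subrr //.
  by rewrite -[X in (X < _)%N]add0n ltn_add2r lt0n size_eq0.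
by rewrite -[X in (X < _)%N]addn0 ltn_add2l lt0n size_eq0.
Qed.
End Characters.

(** * Uniform power bounds for families of word functionals *)

Section Domination.
Context {R : realType} {I : Type} (lam : I -> R).
Hypothesis lam_bounds : forall i, 0 < lam i <= 1.
Implicit Types (f g : I -> R) (b c : R).

(** The index carries a dyadic level together with a position or times, and [lam] is the
    corresponding length; a single [M] for the family makes estimates uniform in all of them. *)
Definition dominated c f :=
  exists2 M, 0 <= M & forall i, `|f i| <= M * lam i `^ c.

Lemma eq_dominated c f g : f =1 g -> dominated c f -> dominated c g.
Proof. by move=> fg [M M0 fM]; exists M => // i; rewrite -fg. Qed.

Lemma dominated_weaken b c f : b <= c -> dominated c f -> dominated b f.
Proof.
move=> bc [M M0 fM]; exists M => // i; apply: le_trans (fM i) _.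
by apply: ler_wpM2l => //; apply: ger_powR.
Qed.

Lemma dominated_add c f g : dominated c f -> dominated c g ->
  dominated c (fun i => f i + g i).
Proof.
move=> [M M0 fM] [N N0 gN]; exists (M + N); rewrite ?addr_ge0 // => i.
by rewrite mulrDl; apply: le_trans (ler_normD _ _) (lerD _ _).
Qed.

Lemma dominated_mul b c f g : dominated b f -> dominated c g ->
  dominated (b + c) (fun i => f i * g i).
Proof.
move=> [M M0 fM] [N N0 gN]; exists (M * N); rewrite ?mulr_ge0 // => i.
have /andP[l0 _] := lam_bounds i.
rewrite normrM powRD; last by apply/implyP => _; rewrite gt_eqF.
by rewrite mulrACA ler_pM.
Qed.

Lemma dominated_cst k : dominated 0 (fun=> k).
Proof. by exists `|k| => // i; rewrite powRr0 mulr1. Qed.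

Lemma dominated_scale k c f : dominated c f -> dominated c (fun i => k * f i).
Proof. by move=> /(dominated_mul (dominated_cst k)); rewrite add0r. Qed.

Lemma dominated_opp c f : dominated c f -> dominated c (fun i => - f i).
Proof. by case=> M M0 fM; exists M => // i; rewrite normrN. Qed.

Lemma dominated_sum c (T : eqType) (s : seq T) (F : I -> T -> R) :
  (forall t, t \in s -> dominated c (F^~ t)) ->
  dominated c (fun i => \sum_(t <- s) F i t).
Proof.
elim: s => [|t s IH] Fd.
  by exists 0 => // i; rewrite big_nil normr0 mul0r.
apply: (@eq_dominated _ (fun i => F i t + \sum_(t <- s) F i t)).
  by move=> i; rewrite big_cons.
apply: dominated_add; first by apply: Fd; rewrite mem_head.
by apply: IH => t' t's; apply: Fd; rewrite inE t's orbT.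
Qed.

Context {d : nat} (gamma : 'I_d -> R).
Hypothesis gamma_gt0 : forall a, 0 < gamma a.

Lemma omega_ge0 (w : word d) : 0 <= omega gamma w.
Proof. by apply: sumr_ge0 => a _; apply: ltW. Qed.

Context (cut : R).
Hypothesis cut_gt0 : 0 < cut.

(* Capping the weight at a level below 1 keeps it subadditive, so that one
   estimate covers all words at once, including those of weight above 1. *)
Definition capped_weight (w : word d) : R := Num.min (omega gamma w) cut.

Lemma capped_weight_ge0 w : 0 <= capped_weight w.
Proof. by rewrite /capped_weight le_min omega_ge0 ltW. Qed.

Lemma capped_weight_nil : capped_weight [::] = 0.
Proof. by rewrite /capped_weight /omega big_nil min_l // ltW. Qed.

Lemma capped_weight_cat u v :
  capped_weight (u ++ v) <= capped_weight u + capped_weight v.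
Proof.
rewrite /capped_weight; have -> : omega gamma (u ++ v) = omega gamma u + omega gamma v.
  by rewrite /omega big_cat.
have u0 := omega_ge0 u; have v0 := omega_ge0 v; have c0 := cut_gt0.
by case: (leP (omega gamma u) cut) => ?; case: (leP (omega gamma v) cut) => ?;
  case: (leP (_ + _) cut) => ?; lra.
Qed.

Implicit Types (F G X : I -> word d -> R) (u v w : word d).

Definition word_dominated F w := dominated (capped_weight w) (F^~ w).

Lemma dominated_deconcatenation F G w p : p \in deconcatenation w ->
  word_dominated F p.1 -> word_dominated G p.2 ->
  dominated (capped_weight w) (fun i => F i p.1 * G i p.2).
Proof.
move=> /mem_deconcatenation <- Fp Gp.
by apply: dominated_weaken (capped_weight_cat _ _) _; apply: dominated_mul.
Qed.

Lemma conv_dominated F G w :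
  (forall u, (size u <= size w)%N -> word_dominated F u) ->
  (forall u, (size u <= size w)%N -> word_dominated G u) ->
  word_dominated (fun i => conv (F i) (G i)) w.
Proof.
move=> Fd Gd; apply: dominated_sum => p pw.
by apply: dominated_deconcatenation => //; [apply: Fd; apply: size_fst_le |
  apply: Gd; apply: size_snd_le].
Qed.

Lemma pconv_dominated F G w :
  (forall u, (size u < size w)%N -> word_dominated F u) ->
  (forall u, (size u < size w)%N -> word_dominated G u) ->
  word_dominated (fun i => pconv (F i) (G i)) w.
Proof.
move=> Fd Gd; apply: dominated_sum => p pw.
have zero : dominated (capped_weight w) (fun=> 0).
  by exists 0 => // i; rewrite normr0 mul0r.
have [p1|p1] := eqVneq p.1 [::].
  by apply: eq_dominated zero => i; rewrite p1 mul0r.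
have [p2|p2] := eqVneq p.2 [::].
  by apply: eq_dominated zero => i; rewrite p2 mulr0.
apply: (@eq_dominated _ (fun i => F i p.1 * G i p.2)).
  by move=> i; case: (p.1) p1 (p.2) p2 => [//|a u] _ [].
have [pu pv] := proper_deconcatenation pw p1 p2.
by apply: dominated_deconcatenation => //; [apply: Fd | apply: Gd].
Qed.

Lemma word_dominated_nil F : (forall i, F i [::] = 1) -> word_dominated F [::].
Proof.
move=> F1; rewrite /word_dominated capped_weight_nil.
by apply: (@eq_dominated _ (fun=> 1)) (dominated_cst 1) => i; rewrite F1.
Qed.

(** The recursion uses only sums, scalings and [pconv], and these respect the bound because the
    capped weight is subadditive. *)
Lemma wroot_dominated X w :
  (forall u, (size u <= size w)%N -> word_dominated X u) ->
  word_dominated (fun i => wroot (X i)) w.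
Proof.
elim/word_size_ind: w => -[|a w] IH Xd.
  by apply: word_dominated_nil => i; rewrite wrootE.
have Yd u : (size u < size (a :: w))%N -> word_dominated (fun i => wroot (X i)) u.
  move=> uw; apply: IH => // z zu; apply: Xd.
  by apply: leq_trans zu (ltnW uw).
apply: (@eq_dominated _ (fun i => 2^-1 * (X i (a :: w) +
    - pconv (wroot (X i)) (wroot (X i)) (a :: w)))).
  by move=> i; rewrite wrootE mulrC.
by apply/dominated_scale/dominated_add; [apply: Xd | apply/dominated_opp/pconv_dominated].
Qed.

Lemma winv_dominated X w :
  (forall u, (size u <= size w)%N -> word_dominated X u) ->
  word_dominated (fun i => winv (X i)) w.
Proof.
elim/word_size_ind: w => -[|a w] IH Xd.
  by apply: word_dominated_nil => i; rewrite winvE.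
have Yd u : (size u < size (a :: w))%N -> word_dominated (fun i => winv (X i)) u.
  move=> uw; apply: IH => // z zu; apply: Xd.
  by apply: leq_trans zu (ltnW uw).
apply: (@eq_dominated _ (fun i => - X i (a :: w) +
    - pconv (winv (X i)) (X i) (a :: w))).
  by move=> i; rewrite [RHS]winvE.
apply: dominated_add; first by apply/dominated_opp/Xd.
apply/dominated_opp/pconv_dominated => // u uw; apply: Xd; exact: ltnW.
Qed.

Lemma letter_exp_dominated (h : I -> 'I_d -> R) w :
  (forall a, dominated (capped_weight [:: a]) (h^~ a)) ->
  word_dominated (fun i => letter_exp (h i)) w.
Proof.
move=> hd; apply: (@eq_dominated _
  (fun i => (size w)`!%:R^-1 * \prod_(a <- w) h i a)).
  by move=> i; rewrite mulrC.
apply: dominated_scale; elim: w => [|a w IH].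
  rewrite capped_weight_nil.
  by apply: eq_dominated (dominated_cst 1) => i; rewrite big_nil.
apply: (@eq_dominated _ (fun i => h i a * \prod_(b <- w) h i b)).
  by move=> i; rewrite big_cons.
apply: dominated_weaken (capped_weight_cat [:: a] w) _.
exact: dominated_mul.
Qed.
End Domination.

(** * The tree of characters over dyadic intervals *)

Section DyadicTree.
Context {R : realType} {d : nat} (y : 'I_d -> R -> R).

Definition grid (m k : nat) : R := k%:R * 2^-1 ^+ m.

Lemma grid_half m k : grid m.+1 k.*2 = grid m k.
Proof. by rewrite /grid exprS mulrA -muln2 natrM mulfK ?pnatr_eq0. Qed.

Lemma gridS m k : grid m k.+1 = grid m k + 2^-1 ^+ m.
Proof. by rewrite /grid -addn1 natrD mulrDl mul1r. Qed.

(** What must be added to half the increment over the interval to get the increment over its left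
    half; the right half needs the opposite correction. *)
Definition midpoint_defect m k (i : 'I_d) : R :=
  y i (grid m.+1 k.*2.+1) - (y i (grid m k) + y i (grid m k.+1)) / 2.

(* [tree m k] is the element over the dyadic interval from [grid m k] to
   [grid m k.+1]; letters are corrected on both sides of a square root. *)
Fixpoint tree m k : word d -> R :=
  if m is m'.+1 then
    let Y := wroot (tree m' k./2) in
    let E := letter_exp (midpoint_defect m' k./2) in
    if odd k then conv (winv E) Y else conv Y E
  else letter_exp (fun i => y i (grid 0 k.+1) - y i (grid 0 k)).

Lemma tree_character m k : is_character (tree m k).
Proof.
elim: m k => [|m IH] k /=; first exact: letter_exp_character.
have Y := wroot_character (IH k./2).
have E := letter_exp_character (midpoint_defect m k./2).
by case: ifP => _; apply: conv_character => //; apply: winv_character.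
Qed.

Lemma tree_nil m k : tree m k [::] = 1.
Proof. by case: (tree_character m k). Qed.

(** The two corrections meet in the middle and cancel, leaving the square of the root. *)
Lemma tree_split m k : conv (tree m.+1 k.*2) (tree m.+1 k.*2.+1) = tree m k.
Proof.
rewrite /= odd_double /= doubleK uphalf_double convA convKr ?conv_wroot ?tree_nil //.
by have [] := letter_exp_character (midpoint_defect m k).
Qed.

Lemma tree_letter m k i : tree m k [:: i] = y i (grid m k.+1) - y i (grid m k).
Proof.
have letterE h : letter_exp h [:: i] = h i :> R by rewrite /letter_exp big_seq1 divr1.
elim: m k => [|m IH] k; first by rewrite /= letterE.
have pc f g : pconv f g [:: i] = 0 :> R.
  by rewrite /pconv conv_letter /= mul0r mulr0 addr0.
rewrite /=; set E := letter_exp _; have E1 : E [::] = 1.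
  by have [] := letter_exp_character (midpoint_defect m k./2).
set Y := wroot _; have Y1 : Y [::] = 1 by rewrite /Y wrootE.
have YE : Y [:: i] = (y i (grid m k./2.+1) - y i (grid m k./2)) / 2.
  by rewrite /Y wrootE pc IH subr0.
have := odd_double_half k; case: ifP => _ kE.
  rewrite conv_letter winv_nil Y1 YE winvE pc /E letterE /midpoint_defect -[in RHS]kE.
  by rewrite add1n -doubleS grid_half; field.
by rewrite conv_letter E1 Y1 YE /E letterE /midpoint_defect -[in RHS]kE grid_half; field.
Qed.

Context (gamma : 'I_d -> R).
Hypothesis gamma_gt0 : forall a, 0 < gamma a.
Hypothesis y_holder : forall i, exists2 C : R, 0 <= C &
  forall s t, `|y i t - y i s| <= C * `|t - s| `^ gamma i.
Context (cut : R).
Hypothesis cut_bounds : 0 < cut < 1.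

Definition dyadic_scale (p : nat * nat) : R := 2^-1 ^+ p.1.

Lemma half_exp_bounds m : 0 < (2^-1 : R) ^+ m <= 1.
Proof.
rewrite exprn_gt0 ?invr_gt0 ?ltr0n //= exprn_ile1 ?invr_ge0 ?ler0n //.
by rewrite invf_le1 ?ltr0n ?ler1n.
Qed.

Lemma half_ltr_powR (b c : R) : b < c -> 2^-1 `^ c < 2^-1 `^ b :> R.
Proof.
have h0 : 0 < 2^-1 :> R by rewrite invr_gt0 ltr0n.
have h1 : 2^-1 < 1 :> R by rewrite invf_lt1 ?ltr0n ?ltr1n.
by move=> bc; rewrite /powR (gt_eqF h0) ltr_expR ltr_nM2r // ln_lt0 // h0 h1.
Qed.

Lemma midpoint_defect_dominated a :
  dominated dyadic_scale (capped_weight gamma cut [:: a])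
    (fun p => midpoint_defect p.1 p.2 a).
Proof.
apply: (@dominated_weaken _ _ _ _ _ (gamma a)) => [p||].
- exact: half_exp_bounds.
- by rewrite /capped_weight /omega big_seq1 ge_min lexx.
have [C C0 hC] := y_holder a; exists C => // -[m k] /=.
have half : `|2^-1 ^+ m.+1| `^ gamma a <= (2^-1 ^+ m) `^ gamma a.
  have /andP[l0 _] := half_exp_bounds m; have /andP[l0' _] := half_exp_bounds m.+1.
  rewrite gtr0_norm //; apply: ge0_ler_powR; rewrite ?nnegrE; try exact: ltW.
  by rewrite exprS ler_piMl ?(ltW l0) // invf_le1 // ler1n.
have l : `|y a (grid m.+1 k.*2.+1) - y a (grid m k)| <= C * (2^-1 ^+ m) `^ gamma a.
  apply: le_trans (hC _ _) _; rewrite -(grid_half m k) gridS addrC addKr.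
  by rewrite ler_wpM2l.
have r : `|y a (grid m.+1 k.*2.+1) - y a (grid m k.+1)| <= C * (2^-1 ^+ m) `^ gamma a.
  rewrite distrC; apply: le_trans (hC _ _) _.
  by rewrite -(grid_half m k.+1) doubleS (gridS _ k.*2.+1) addrC addKr ler_wpM2l.
rewrite /midpoint_defect; move: l r; rewrite !ler_norml => /andP[? ?] /andP[? ?].
by apply/andP; split; lra.
Qed.

(** Induction on length, then on level. A child's value on [w] is half its parent's plus an error
    controlled by shorter words and letter corrections, while the required bound shrinks only by
    [q > 1/2] per level. *)
Lemma tree_dominated w : word_dominated dyadic_scale gamma cut
  (fun p => tree p.1 p.2) w.
Proof.
have /andP[cut0 cut1] := cut_bounds.
have lamP (p : nat * nat) : 0 < dyadic_scale p <= 1 by apply: half_exp_bounds.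
elim/word_size_ind: w => -[|a w0] IH.
  by apply: word_dominated_nil => // p; apply: tree_nil.
set w := a :: w0 in IH *.
pose X (p : nat * nat) := tree p.1 p.2.
pose Y p := wroot (X p).
pose E (p : nat * nat) := letter_exp (midpoint_defect p.1 p.2).
have E1 p : E p [::] = 1.
  by have [] := letter_exp_character (midpoint_defect p.1 p.2).
have Y1 p : Y p [::] = 1 by rewrite /Y wrootE.
have Ed u : word_dominated dyadic_scale gamma cut E u.
  by apply: letter_exp_dominated => // b; apply: midpoint_defect_dominated.
have E'd u : word_dominated dyadic_scale gamma cut (fun p => winv (E p)) u.
  exact: winv_dominated.
have Yd u : (size u < size w)%N -> word_dominated dyadic_scale gamma cut Y u.
  move=> uw; apply: wroot_dominated => // z zu; apply: IH.
  exact: leq_ltn_trans zu uw.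
have YYd := pconv_dominated lamP gamma_gt0 cut0 Yd Yd.
(* The error after removing half the parent's value: [e] comes from the letter correction, the
   [pconv] term from the square root. [K0] will bound it for left children and [K1] for right
   ones. *)
have halfd (e : nat * nat -> R) : dominated dyadic_scale (capped_weight gamma cut w) e ->
    dominated dyadic_scale (capped_weight gamma cut w)
      (fun p => e p + - 2^-1 * pconv (Y p) (Y p) w).
  by move=> ed; apply: dominated_add => //; apply: dominated_scale.
have [K0 K00 K0P] := halfd _ (dominated_add (Ed w)
  (pconv_dominated lamP gamma_gt0 cut0 Yd (fun u _ => Ed u))).
have [K1 K10 K1P] := halfd _ (dominated_add (E'd w)
  (pconv_dominated lamP gamma_gt0 cut0 (fun u _ => E'd u) Yd)).
have [M0 M00 M0P] : exists2 M, 0 <= M & forall k, `|tree 0 k w| <= M.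
  (* Intervals of level 0 have length 1, so the constant scale 1 applies. *)
  have : word_dominated (fun=> 1) gamma cut (fun k => tree 0 k) w.
    apply: letter_exp_dominated => // [_|b]; first by rewrite ltr01 lexx.
    have [C C0 hC] := y_holder b; exists C => // k.
    have gE : grid 0 k.+1 - grid 0 k = 1 by rewrite gridS expr0 addrC addKr.
    by have := hC (grid 0 k) (grid 0 k.+1); rewrite gE normr1 !powR1.
  by case=> M M_ge0 MP; exists M => // k; have := MP k; rewrite powR1 mulr1.
set th := capped_weight gamma cut w in K0P K1P *.
have q2 : 2^-1 < 2^-1 `^ th.
  rewrite -[X in X < _]powRr1; last by rewrite invr_ge0.
  by apply: half_ltr_powR; rewrite /th /capped_weight gt_min cut1 orbT.
set q := 2^-1 `^ th in q2.
have q0 : 0 < q - 2^-1 by rewrite subr_gt0.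
(* Chosen so that [M / 2 + (K0 + K1) <= M * q], which closes the induction on the level. *)
pose M := M0 + (K0 + K1) / (q - 2^-1).
have K_ge0 : 0 <= (K0 + K1) / (q - 2^-1) by apply: divr_ge0 (addr_ge0 _ _) (ltW _).
have MK : K0 + K1 <= M * (q - 2^-1).
  by rewrite mulrDl mulfVK ?gt_eqF // lerDr mulr_ge0 // ltW.
have M_ge0 : 0 <= M by apply: addr_ge0.
exists M => // -[m k] /=; elim: m k => [|m IHm] k.
  by rewrite powR1 mulr1 (le_trans (M0P k)) // lerDl.
have lE : dyadic_scale (m.+1, k) `^ th = q * (2^-1 ^+ m) `^ th.
  by rewrite /dyadic_scale exprS powRM // ?exprn_ge0 // invr_ge0.
rewrite lE; set l := (2^-1 ^+ m) `^ th; have l0 : 0 <= l by apply: powR_ge0.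
have K : `|tree m.+1 k w - 2^-1 * tree m k./2 w| <= (K0 + K1) * l.
  have Yw : wroot (tree m k./2) w = 2^-1 * tree m k./2 w +
      - 2^-1 * pconv (Y (m, k./2)) (Y (m, k./2)) w.
    by rewrite wrootE /= mulrC mulrBr mulNr.
  have Yn := Y1 (m, k./2); have En := E1 (m, k./2); rewrite /Y /X /E /= in Yn En.
  rewrite [tree m.+1 k]/=; case: ifP => _.
    rewrite conv_pconv ?winv_nil ?Yn // Yw mulrDl.
    apply: le_trans (_ : _ <= K1 * l) _; last by rewrite lerDr mulr_ge0.
    by apply: le_trans (K1P (m, k./2)); rewrite le_eqVlt; apply/orP; left; apply/eqP;
      congr `|_|; rewrite /E /Y /X /=; ring.
  rewrite conv_pconv ?Yn ?En // Yw mulrDl.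
  apply: le_trans (_ : _ <= K0 * l) _; last by rewrite lerDl mulr_ge0.
  by apply: le_trans (K0P (m, k./2)); rewrite le_eqVlt; apply/orP; left; apply/eqP;
    congr `|_|; rewrite /E /Y /X /=; ring.
have T := IHm k./2; rewrite -[tree m.+1 k w](subrK (2^-1 * tree m k./2 w)).
apply: le_trans (ler_normD _ _) _; rewrite normrM ger0_norm ?invr_ge0 //.
have MKl := ler_wpM2r l0 MK; rewrite mulrBr mulrBl in MKl.
by move: K T; rewrite /dyadic_scale /= -/l; lra.
Qed.
End DyadicTree.
Local Open Scope classical_set_scope.

(** * Limits of sequences and of convolutions *)

Section Limits.
Context {R : realType}.
Implicit Types (u : R^nat).

Lemma exprn_powR (a c : R) n : 0 <= a -> (a ^+ n) `^ c = (a `^ c) ^+ n.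
Proof.
move=> a0; rewrite -powR_mulrn // -[RHS]powR_mulrn ?powR_ge0 //.
by rewrite -!powRrM mulrC.
Qed.

Lemma cvg_geometric_increments u K rho : 0 <= rho < 1 ->
  (forall n, `|u n.+1 - u n| <= K * rho ^+ n) -> cvgn u.
Proof.
move=> /andP[rho0 rho1] uK.
have K0 : 0 <= K by have := le_trans (normr_ge0 _) (uK 0%N); rewrite mulr1.
have -> : u = (fun n => u 0%N + series (telescope u) n).
  by apply/funext => n; apply: eq_sum_telescope.
apply: is_cvgD; first exact: is_cvg_cst.
apply: normed_cvg; apply: (@series_le_cvg _ _ (geometric K rho)) => [n|n|n|] //=.
- by rewrite mulr_ge0 // exprn_ge0.
- exact: uK.
by apply: is_cvg_geometric_series; rewrite ger0_norm.
Qed.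

Lemma norm_lim_le u (l M : R) : u @ \oo --> l -> (forall n, `|u n| <= M) -> `|l| <= M.
Proof.
move=> /cvg_norm ul uM; have <- : limn (fun n => `|u n|) = `|l| by apply: cvg_lim.
apply: limr_le; first by apply/cvg_ex; exists `|l|.
exact: nearW.
Qed.

Lemma cvg_sum_seq (T : Type) (s : seq T) (F : T -> R^nat) (l : T -> R) :
  (forall t, F t @ \oo --> l t) ->
  (fun n => \sum_(t <- s) F t n) @ \oo --> \sum_(t <- s) l t.
Proof.
move=> Fl; elim: s => [|t s IH].
  by rewrite big_nil (_ : (fun=> _) = cst 0); [exact: cvg_cst |
    apply/funext => n; rewrite big_nil].
rewrite big_cons (_ : (fun=> _) = F t \+ (fun n => \sum_(t <- s) F t n)).
  exact: cvgD.
by apply/funext => n; rewrite big_cons.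
Qed.

Lemma conv_cvg {d : nat} (F G : nat -> word d -> R) (f g : word d -> R) w :
  (forall v, F^~ v @ \oo --> f v) -> (forall v, G^~ v @ \oo --> g v) ->
  (fun n => conv (F n) (G n) w) @ \oo --> conv f g w.
Proof.
move=> Ff Gg.
by apply: (cvg_sum_seq (F := fun p n => F n p.1 * G n p.2)) => p; apply: cvgM.
Qed.

End Limits.

(** * Dyadic products, their limit, and the regularity of its increments *)

Section DyadicLimit.
Context {R : realType} {d : nat} (y : 'I_d -> R -> R) (gamma : 'I_d -> R).

Lemma gamma_hat_le i : gamma_hat gamma <= gamma i.
Proof. by rewrite /gamma_hat (bigD1 i) //= ge_min lexx. Qed.

Hypothesis gamma_gt0 : forall a, 0 < gamma a.

Lemma gamma_hat_gt0 : 0 < gamma_hat gamma.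
Proof.
rewrite /gamma_hat; elim/big_ind: _ => // a b a0 b0.
by rewrite lt_min a0.
Qed.

Lemma gamma_hat_omega (w : word d) : gamma_hat gamma * (size w)%:R <= omega gamma w.
Proof.
rewrite /omega; elim: w => [|a w IH]; first by rewrite mulr0 big_nil.
by rewrite big_cons /= mulrS mulrDr mulr1 lerD // gamma_hat_le.
Qed.

(** The ordered product standing for the lifted path from time 0 to [grid m k]. *)
Fixpoint walk m k : word d -> R :=
  if k is k'.+1 then conv (walk m k') (tree y m k') else unitw.

Lemma walk_character m k : is_character (walk m k).
Proof.
elim: k => [|k IH]; first exact: unitw_character.
exact: conv_character IH (tree_character y m k).
Qed.

Lemma walk_refine m k : walk m.+1 k.*2 = walk m k.
Proof. by elim: k => // k IH; rewrite doubleS [LHS]/= convA tree_split IH. Qed.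

Lemma walk_letter m k i : walk m k [:: i] = y i (grid m k) - y i 0.
Proof.
elim: k => [|k IH]; first by rewrite /grid mul0r subrr.
rewrite /= conv_letter IH tree_letter tree_nil.
by have [-> _] := walk_character m k; ring.
Qed.

Definition dyadic_index m (t : R) : nat := Num.truncn (2 ^+ m * t).

Lemma dyadic_indexS m t : (dyadic_index m.+1 t)./2 = dyadic_index m t.
Proof.
rewrite /dyadic_index; have [t0|t0] := leP 0 t; last first.
  have neg n : Num.truncn (2 ^+ n * t) = 0%N.
    by rewrite truncn_floor ifF // pmulr_rge0 ?exprn_gt0 // lt_geF.
  by rewrite !neg.
have t1 : 0 <= 2 ^+ m.+1 * t by rewrite mulr_ge0 // exprn_ge0.
have := truncn_itv t1; set q := Num.truncn _ => /andP[q1 q2].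
apply/esym/truncn_def; have := odd_double_half q; set k := q./2 => qE.
have k1 : (k.*2 <= q)%N by lia.
have k2 : (q.+1 <= k.+1.*2)%N by move: qE; case: (odd q) => /=; lia.
move: k1 k2; rewrite -!(ler_nat R) -!muln2 !natrM => k1 k2.
by move: q1 q2 k1 k2; rewrite exprS; set T := 2 ^+ m * t; rewrite -mulrA -/T => *;
  apply/andP; split; lra.
Qed.

Lemma grid_dyadic_index m t : 0 <= t ->
  grid m (dyadic_index m t) <= t < grid m (dyadic_index m t).+1.
Proof.
move=> t0; have p : 0 < 2 ^+ m :> R by rewrite exprn_gt0.
have t1 : 0 <= 2 ^+ m * t by rewrite mulr_ge0 // ltW.
by rewrite /grid !exprVn ler_pdivrMr // ltr_pdivlMr // mulrC truncn_itv.
Qed.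

Definition approx m t := walk m (dyadic_index m t).

Lemma approx_character m t : is_character (approx m t).
Proof. exact: walk_character. Qed.

Lemma approx_nil m t : approx m t [::] = 1.
Proof. by case: (approx_character m t). Qed.

(** Refining turns the index [q] of [t] into [2q] or [2q+1]. Only in the odd case is there one more
    interval before [t], numbered by the predecessor of the new index. *)
Definition dyadic_step m t : word d -> R :=
  if odd (dyadic_index m.+1 t) then tree y m.+1 (dyadic_index m.+1 t).-1 else unitw.

Lemma dyadic_step_nil m t : dyadic_step m t [::] = 1.
Proof. by rewrite /dyadic_step; case: ifP; rewrite ?tree_nil // /unitw eqxx. Qed.

Lemma approxS m t : approx m.+1 t = conv (approx m t) (dyadic_step m t).
Proof.
rewrite /approx /dyadic_step -(dyadic_indexS m) -(walk_refine m).
set q := dyadic_index m.+1 t; have := odd_double_half q; case: ifP => _ qE.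
  have {}qE : q = q./2.*2.+1 by rewrite -[LHS]qE add1n.
  by rewrite {1 3}qE.
by rewrite -[in LHS]qE convf1.
Qed.

Definition segment m n t := conv (winv (approx m t)) (approx (m + n) t).

Lemma segment0 m t : segment m 0 t = unitw.
Proof. by rewrite /segment addn0 conv_winvl // approx_nil. Qed.

Lemma segmentS m n t : segment m n.+1 t = conv (segment m n t) (dyadic_step (m + n) t).
Proof. by rewrite /segment addnS approxS convA. Qed.

Lemma segment_nil m n t : segment m n t [::] = 1.
Proof. by rewrite /segment conv_nil winv_nil approx_nil mulr1. Qed.

Hypothesis y_holder : forall i, exists2 C : R, 0 <= C &
  forall s t, `|y i t - y i s| <= C * `|t - s| `^ gamma i.

(** * Geometric convergence of the refinements *)

Section Estimates.
Context (cut : R).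
Hypothesis cut_bounds : 0 < cut < 1.

Let cut_gt0 : 0 < cut. Proof. by case/andP: cut_bounds. Qed.
(** The slowest decay per level: every nonempty word has capped weight at least this exponent. *)
Let rho : R := 2^-1 `^ Num.min (gamma_hat gamma) cut.

Lemma rho_bounds : 0 < rho < 1.
Proof.
rewrite powR_gt0 ?invr_gt0 //= -[X in _ < X](powRr0 2^-1).
by apply: half_ltr_powR; rewrite lt_min gamma_hat_gt0.
Qed.

Lemma capped_weight_cons a w :
  Num.min (gamma_hat gamma) cut <= capped_weight gamma cut (a :: w).
Proof.
rewrite /capped_weight le_min !ge_min lexx orbT andbT; apply/orP; left.
apply: le_trans (gamma_hat_omega _); rewrite ler_peMr ?ler1n //.
exact/ltW/gamma_hat_gt0.
Qed.

Definition scale3 (p : nat * nat * R) : R := 2^-1 ^+ p.1.1.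

Let scale3_bounds p : 0 < scale3 p <= 1. Proof. exact: half_exp_bounds. Qed.

(** Dividing by [rho] to the number of refinements encodes the extra decay of a step beyond the
    starting level. The empty word is removed because its value 1 does not decay. *)
Lemma dyadic_step_dominated w : word_dominated scale3 gamma cut
  (fun p w => rho ^- p.1.2 * reduced (dyadic_step (p.1.1 + p.1.2) p.2) w) w.
Proof.
case: w => [|a w].
  by exists 0 => // i; rewrite mulr0 normr0 mul0r.
have [M M0 MP] := tree_dominated gamma_gt0 y_holder cut_bounds (a :: w).
exists M => // -[[m l] t] /=; rewrite /scale3 /=.
have /andP[r0 r1] := rho_bounds; set th := capped_weight _ _ _ in MP *.
rewrite normrM ger0_norm ?invr_ge0 ?exprn_ge0 ?(ltW r0) //.
rewrite mulrC ler_pdivrMr ?exprn_gt0 // /dyadic_step; case: ifP => _; last first.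
  by rewrite /unitw normr0 !mulr_ge0 ?powR_ge0 // exprn_ge0 // ltW.
apply: le_trans (MP (_, _)) _; rewrite -mulrA ler_wpM2l // /dyadic_scale /=.
have h0 n : 0 <= (2^-1 : R) ^+ n by rewrite exprn_ge0 // invr_ge0.
have hth : 0 <= th by apply: capped_weight_ge0.
apply: (@le_trans _ _ ((2^-1 ^+ (m + l)) `^ th)).
  apply: ge0_ler_powR; rewrite ?nnegrE //.
  by rewrite exprS ler_piMl // invf_le1 ?ler1n.
rewrite exprD powRM // ler_wpM2l ?powR_ge0 //.
rewrite exprn_powR ?invr_ge0 //.
apply: lerXn2r; rewrite ?nnegrE ?powR_ge0 //.
apply: ger_powR; last exact: capped_weight_cons.
by have := @half_exp_bounds R 1; rewrite expr1.
Qed.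

Definition segment_family (p : nat * nat * R) := segment p.1.1 p.1.2 p.2.

(** The increment convolves the segment with the reduced step, so it involves the segment on
    strictly shorter words only. *)
Lemma segment_increment w :
  (forall u, (size u < size w)%N -> word_dominated scale3 gamma cut segment_family u) ->
  exists2 K, 0 <= K & forall m l t, `|segment m l.+1 t w - segment m l t w| <=
    K * (2^-1 ^+ m) `^ capped_weight gamma cut w * rho ^+ l.
Proof.
move=> IH; have /andP[r0 r1] := rho_bounds.
have : word_dominated scale3 gamma cut (fun p => conv (segment_family p)
    (fun w => rho ^- p.1.2 * reduced (dyadic_step (p.1.1 + p.1.2) p.2) w)) w.
  apply: dominated_sum => // p pw.
  have [p2|p2] := eqVneq p.2 [::].
    by exists 0 => // i; rewrite p2 !mulr0 normr0 mul0r.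
  exact: (dominated_deconcatenation scale3_bounds gamma_gt0 cut_gt0 pw
    (IH _ (size_fst_lt pw p2)) (dyadic_step_dominated p.2)).
case=> K K0 KP; exists K => // m l t; have := KP (m, l, t).
rewrite /segment_family /scale3 /= convZr normrM ger0_norm; last first.
  by rewrite invr_ge0 exprn_ge0 // ltW.
rewrite mulrC ler_pdivrMr ?exprn_gt0 // => H; apply: le_trans H.
rewrite segmentS {1}(reducedE (dyadic_step_nil _ _)) convDr convf1.
by rewrite addrC addKr.
Qed.

Lemma segment_dominated w : word_dominated scale3 gamma cut segment_family w.
Proof.
elim/word_size_ind: w => -[|a w] IH.
  by apply: word_dominated_nil => // p; apply: segment_nil.
have [K K0 KP] := segment_increment IH; have /andP[r0 r1] := rho_bounds.
have r1' : 0 < 1 - rho by rewrite subr_gt0.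
exists (K / (1 - rho)) => [|[[m n] t]]; first by rewrite divr_ge0 // ltW.
rewrite /segment_family /scale3 /=; set L := _ `^ _ in KP *.
have L0 : 0 <= L by apply: powR_ge0.
(* The induction on [n] carries the exact partial geometric sum. *)
apply: (@le_trans _ _ (K * L * ((1 - rho ^+ n) / (1 - rho)))); last first.
  rewrite [leRHS]mulrAC ler_wpM2l ?mulr_ge0 // ler_piMl ?invr_ge0 ?(ltW r1') //.
  by rewrite gerBl exprn_ge0 // ltW.
elim: n => [|n IHn].
  by rewrite segment0 /unitw normr0 expr0 subrr mul0r mulr0.
have -> : (1 - rho ^+ n.+1) / (1 - rho) = (1 - rho ^+ n) / (1 - rho) + rho ^+ n.
  by rewrite exprS; field; rewrite gt_eqF.
rewrite mulrDr -[segment m n.+1 t _](subrK (segment m n t (a :: w))) addrC.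
exact: le_trans (ler_normD _ _) (lerD IHn (KP _ _ _)).
Qed.

Lemma segment_cvg m t w : cvgn (fun n => segment m n t w).
Proof.
have [K K0 KP] := @segment_increment w (fun u _ => segment_dominated u).
have /andP[r0 r1] := rho_bounds.
by apply: (@cvg_geometric_increments _ _ _ rho) (KP m ^~ t); rewrite ltW.
Qed.
End Estimates.

Definition limit_path t : word d -> R := fun w => limn (fun n => approx n t w).

Lemma approx_cvg t w : (fun n => approx n t w) @ \oo --> limit_path t w.
Proof.
have half : 0 < (2^-1 : R) < 1 by rewrite invr_gt0 ltr0n invf_lt1 ?ltr0n ?ltr1n.
apply/cvg_ex; exists (conv (approx 0 t) (fun u => limn (fun n => segment 0 n t u)) w).
rewrite (_ : (fun n => approx n t w) = fun n => conv (approx 0 t) (segment 0 n t) w).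
  apply: conv_cvg => u; first exact: cvg_cst.
  (* Convergence holds with any cap strictly between 0 and 1; one half is an arbitrary choice. *)
  exact: (@segment_cvg 2^-1).
by apply/funext => n; rewrite /segment convKr ?approx_nil.
Qed.

(** Each shuffle identity is a finite polynomial relation between values, so it passes to the
    limit. *)
Lemma limit_path_character t : is_character (limit_path t).
Proof.
split=> [|u v].
  apply: cvg_unique (@approx_cvg t [::]) _ => //.
  have -> : (fun n => approx n t [::]) = cst 1.
    by apply/funext => n; apply: approx_nil.
  exact: cvg_cst.
apply/esym; apply: cvg_unique (cvgM (@approx_cvg t u) (@approx_cvg t v)) _ => //.
rewrite (_ : _ \* _ = fun n => shuffle_sum (approx n t) u v).
  by apply: (cvg_sum_seq (F := fun w n => approx n t w)) => w; apply: approx_cvg.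
by apply/funext => n; have [_ ->] := approx_character n t.
Qed.

Lemma limit_path_nil t : limit_path t [::] = 1.
Proof. by case: (limit_path_character t). Qed.

Lemma limit_path_letter t i : 0 <= t -> limit_path t [:: i] = y i t - y i 0.
Proof.
move=> t0; apply: cvg_unique (@approx_cvg t [:: i]) _ => //.
have [C C0 hC] := y_holder i.
have half : 0 < (2^-1 : R) by rewrite invr_gt0 ltr0n.
pose r : R := 2^-1 `^ gamma i; have r0 : 0 < r by rewrite powR_gt0.
have r1 : r < 1 by rewrite -[X in _ < X](powRr0 2^-1) half_ltr_powR.
have E n : `|approx n t [:: i] - (y i t - y i 0)| <= geometric C r n.
  rewrite /approx walk_letter opprB addrA subrK; apply: le_trans (hC _ _) _.
  rewrite ler_wpM2l // -exprn_powR ?(ltW half) //.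
  have /andP[g1 g2] := grid_dyadic_index n t0.
  apply: ge0_ler_powR; rewrite ?nnegrE ?exprn_ge0 ?(ltW half) ?(ltW (gamma_gt0 i)) //.
  by move: g2; rewrite gridS ler0_norm ?subr_le0 //; lra.
have g0 : geometric C r @ \oo --> 0 by apply: cvg_geometric; rewrite gtr0_norm.
set l := y i t - y i 0 in E *.
apply: (@squeeze_cvgr _ _ _ _ (fun n => l - geometric C r n) (fun n => l + geometric C r n)).
- by apply: nearW => n; have := E n; rewrite ler_norml; lra.
- by rewrite -[X in _ --> X]subr0; apply: cvgB => //; exact: cvg_cst.
- by rewrite -[X in _ --> X]addr0; apply: cvgD => //; exact: cvg_cst.
Qed.

Definition increments s t := conv (winv (limit_path s)) (limit_path t).

Lemma increments_character s t : is_character (increments s t).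
Proof.
by apply: conv_character; [apply: winv_character|]; apply: limit_path_character.
Qed.

Lemma increments_letter s t i : 0 <= s -> 0 <= t ->
  increments s t [:: i] = y i t - y i s.
Proof.
move=> s0 t0; rewrite /increments conv_letter winv_nil limit_path_nil winvE.
rewrite /pconv conv_letter /= mul0r mulr0 addr0 subr0 !limit_path_letter //; ring.
Qed.

Lemma increments_conv s u t : conv (increments s u) (increments u t) = increments s t.
Proof. by rewrite /increments convA convKr ?limit_path_nil. Qed.

Definition tail m t := conv (winv (approx m t)) (limit_path t).

Lemma tail_nil m t : tail m t [::] = 1.
Proof. by rewrite /tail conv_nil winv_nil limit_path_nil mulr1. Qed.

Lemma tail_bound cut w : 0 < cut < 1 -> exists2 M, 0 <= M & forall m t,
  `|tail m t w| <= M * (2^-1 ^+ m) `^ capped_weight gamma cut w.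
Proof.
move=> cutP; have [M M0 MP] := segment_dominated cutP w.
exists M => // m t; apply: (@norm_lim_le _ (fun n => segment m n t w)); last first.
  by move=> n; apply: (MP (m, n, t)).
apply: conv_cvg => u; first exact: cvg_cst.
have := @approx_cvg t u; rewrite -(cvg_shiftn m).
have -> // : (fun n => approx (m + n) t u) = [sequence approx (n + m) t u]_n.
by apply/funext => n; rewrite addnC.
Qed.

(** Isolates the part at level [m]: the middle factor is purely dyadic, and the tails at both ends
    are already small at scale [2^-m]. *)
Lemma increments_tail m s t : increments s t =
  conv (conv (winv (tail m s)) (conv (winv (approx m s)) (approx m t))) (tail m t).
Proof.
have E r : limit_path r = conv (approx m r) (tail m r) by rewrite convKr ?approx_nil.
by rewrite /increments (E s) (E t) winv_conv ?approx_nil ?tail_nil // !convA.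
Qed.

Lemma dyadic_index_near m s t : 0 <= s -> 0 <= t -> `|t - s| <= 2^-1 ^+ m ->
  (dyadic_index m t <= (dyadic_index m s).+1)%N.
Proof.
move=> s0 t0; rewrite ler_norml => /andP[_ ts].
have /andP[_ s1] := grid_dyadic_index m s0; have /andP[t1 _] := grid_dyadic_index m t0.
have : (grid m (dyadic_index m t) : R) < grid m (dyadic_index m s).+2.
  by rewrite gridS; lra.
have /andP[h0 _] := @half_exp_bounds R m.
by rewrite /grid ltr_pM2r // ltr_nat ltnS.
Qed.

Lemma nat_adjacent (a b : nat) : (a <= b.+1)%N -> (b <= a.+1)%N ->
  a = b \/ b = a.+1 \/ a = b.+1.
Proof. lia. Qed.

Lemma dyadic_magnitude (e : R) : 0 < e <= 1 ->
  exists m, 2^-1 ^+ m.+1 < e <= 2^-1 ^+ m.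
Proof.
move=> /andP[e0 e1].
have ex : exists m, 2^-1 ^+ m.+1 < e.
  exists (Num.truncn e^-1); rewrite exprVn invf_plt ?posrE ?exprn_gt0 //.
  have e'0 : 0 <= e^-1 by rewrite invr_ge0 ltW.
  have /andP[_ /lt_le_trans -> //] := truncn_itv e'0.
  by rewrite -natrX ler_nat ltnW // ltn_expl.
exists (ex_minn ex); case: ex_minnP => m -> min /=.
case: m min => [|m] min; first by rewrite expr0.
by rewrite leNgt; apply/negP => /min; rewrite ltnn.
Qed.

(** Take [m] with [2^-m] comparable to the distance. The dyadic indices of [s] and [t] then differ
    by at most one, so the middle factor of [increments_tail] is the unit, a tree element or the
    inverse of one. *)
Lemma increments_holder (w : word d) : omega gamma w < 1 ->
  exists C : R, forall s t, 0 <= s -> 0 <= t -> `|t - s| <= 1 ->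
    `|increments s t w| <= C * `|t - s| `^ omega gamma w.
Proof.
(* The cap must not act on [w] yet stay below 1, which is where [omega gamma w < 1] enters; one half
   keeps it positive for the empty word. *)
move=> w1; pose cut := Num.max (omega gamma w) 2^-1.
have cutP : 0 < cut < 1.
  by rewrite /cut lt_max gt_max w1 invr_gt0 ltr0n orbT invf_lt1 ?ltr0n ?ltr1n.
have cut0 : 0 < cut by case/andP: cutP.
have capE : capped_weight gamma cut w = omega gamma w.
  by rewrite /capped_weight min_l // /cut le_max lexx.
pose lam (p : nat * R * R) : R := 2^-1 ^+ p.1.1.
have lamP p : 0 < lam p <= 1 by apply: half_exp_bounds.
have tail_s u : word_dominated lam gamma cut (fun p => winv (tail p.1.1 p.1.2)) u.
  apply: winv_dominated => // v _.
  by have [M M0 MP] := tail_bound v cutP; exists M => // p; apply: MP.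
have tail_t u : word_dominated lam gamma cut (fun p => tail p.1.1 p.2) u.
  by have [M M0 MP] := tail_bound u cutP; exists M => // p; apply: MP.
have treed (k : nat * R * R -> nat) u :
    word_dominated lam gamma cut (fun p => tree y p.1.1 (k p)) u.
  have [M M0 MP] := tree_dominated gamma_gt0 y_holder cutP u.
  by exists M => // p; apply: (MP (p.1.1, k p)).
have bound (B : nat * R * R -> word d -> R) :
    (forall u, word_dominated lam gamma cut B u) ->
    exists2 M, 0 <= M & forall m s t,
      `|conv (conv (winv (tail m s)) (B (m, s, t))) (tail m t) w| <=
      M * (2^-1 ^+ m) `^ omega gamma w.
  move=> Bd; have : word_dominated lam gamma cut
      (fun p => conv (conv (winv (tail p.1.1 p.1.2)) (B p)) (tail p.1.1 p.2)) w.
    by apply: conv_dominated => // u _; apply: conv_dominated.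
  by case=> M M0 MP; exists M => // m s t; have := MP (m, s, t); rewrite capE.
have unitd u : word_dominated lam gamma cut (fun=> unitw) u.
  case: u => [|a u]; first by apply: word_dominated_nil.
  by exists 0 => // p; rewrite /unitw normr0 mul0r.
(* The three constants cover equal indices, [t] one cell after [s], and [t] one cell before [s]. *)
have [M1 M10 M1P] := bound _ unitd.
have [M2 M20 M2P] := bound _ (treed (fun p => dyadic_index p.1.1 p.1.2)).
have [M3 M30 M3P] := bound (fun p => winv (tree y p.1.1 (dyadic_index p.1.1 p.2)))
  (fun u => winv_dominated lamP gamma_gt0 cut0
    (fun v _ => treed (fun p => dyadic_index p.1.1 p.2) v)).
(* The power of 2 absorbs [2^-m < 2 * |t - s|]; the added 1 covers [s = t] on the empty word, where
   the value and [0] to the power [0] are both 1. *)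
exists ((M1 + M2 + M3) * 2 `^ omega gamma w + 1) => s t s0 t0 ts.
have P0 := powR_ge0 `|t - s| (omega gamma w).
have [tsE|tsN] := eqVneq t s.
  rewrite -tsE subrr normr0 /increments conv_winvl ?limit_path_nil //.
  rewrite /unitw; case: eqVneq => [->|_].
    rewrite /omega big_nil !powRr0 !mulr1 normr1 lerDr.
    by rewrite !addr_ge0.
  by rewrite normr0 mulr_ge0 ?powR_ge0 // addr_ge0 // mulr_ge0 ?powR_ge0 ?addr_ge0.
have tsP : 0 < `|t - s| <= 1 by rewrite normr_gt0 subr_eq0 tsN.
have [m /andP[m1 m2]] := dyadic_magnitude tsP.
set th := omega gamma w in M1P M2P M3P P0 *.
have th0 : 0 <= th by apply: omega_ge0.
set l := (2^-1 ^+ m) `^ th in M1P M2P M3P.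
have l0 : 0 <= (2^-1 ^+ m) `^ th by apply: powR_ge0.
have lts : (2^-1 ^+ m) `^ th <= 2 `^ th * `|t - s| `^ th.
  rewrite -powRM //; apply: ge0_ler_powR; rewrite ?nnegrE ?mulr_ge0 ?exprn_ge0 ?invr_ge0 //.
  by move: m1; rewrite exprS; lra.
apply: (@le_trans _ _ ((M1 + M2 + M3) * (2^-1 ^+ m) `^ th)); last first.
  rewrite [leRHS]mulrDl mul1r -[X in _ <= X + _]mulrA; apply: ler_wpDr => //.
  by rewrite ler_wpM2l // !addr_ge0.
rewrite (increments_tail m) /approx.
have st : `|s - t| <= 2^-1 ^+ m by rewrite distrC.
have := dyadic_index_near s0 t0 m2; have := dyadic_index_near t0 s0 st.
rewrite !mulrDl; have := M1P m s t; have := M2P m s t; have := M3P m s t => /=.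
set a := dyadic_index m s; set b := dyadic_index m t => H3 H2 H1 ab ba.
have M1l := mulr_ge0 M10 l0; have M2l := mulr_ge0 M20 l0; have M3l := mulr_ge0 M30 l0.
have walk1 k : walk m k [::] = 1 by case: (walk_character m k).
have [abE|[abE|abE]] : a = b \/ b = a.+1 \/ a = b.+1.
  by apply: nat_adjacent.
- by rewrite -abE conv_winvl //; apply: le_trans H1 _; lra.
- by rewrite abE /= convKl //; apply: le_trans H2 _; lra.
have T W : W [::] = 1 -> conv (winv (conv W (tree y m b))) W = winv (tree y m b).
  by move=> W1; rewrite winv_conv ?tree_nil // convA conv_winvl // convf1.
rewrite abE /= T //.
by apply: le_trans H3 _; lra.
Qed.
End DyadicLimit.

(** * Restriction to light words and membership in [in_Ga] *)

Section LightWords.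
Context {R : realType} {d : nat} (gamma : 'I_d -> R).
Hypothesis gamma_gt0 : forall a, 0 < gamma a.
Implicit Types (f g a X : word d -> R) (u v w : word d).

Definition restrict_light f : Ha_dual gamma := fun l => f (val l).

Lemma restrict_lightE f w :
  word_pairing (restrict_light f) w = if omega gamma w <= 1 then f w else 0.
Proof. by rewrite /word_pairing; case: insubP => [v -> <-|/negPf ->]. Qed.

Lemma omega_cat u v : omega gamma (u ++ v) = omega gamma u + omega gamma v.
Proof. by rewrite /omega big_cat. Qed.

Lemma light_cat u v : omega gamma (u ++ v) <= 1 ->
  omega gamma u <= 1 /\ omega gamma v <= 1.
Proof.
have u0 := omega_ge0 gamma_gt0 u; have v0 := omega_ge0 gamma_gt0 v.
by rewrite omega_cat => uv; split; lra.
Qed.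

(** Weights are positive, so both pieces of a split light word are light and the default value 0
    never enters. *)
Lemma star_restrict_light f g :
  star (restrict_light f) (restrict_light g) = restrict_light (conv f g).
Proof.
apply/funext => -[w lw]; apply: eq_big_seq => p /= pw.
move: lw; rewrite -(mem_deconcatenation pw) => /light_cat[l1 l2].
by rewrite !restrict_lightE l1 l2.
Qed.

Lemma counit_restrict_light : @counit R d gamma = restrict_light unitw.
Proof. by []. Qed.

Lemma size_light w : omega gamma w <= 1 -> (size w <= N_hat gamma)%N.
Proof.
move=> lw; have g0 := gamma_hat_gt0 gamma_gt0.
rewrite /N_hat truncn_ge_nat ?invr_ge0 ?(ltW g0) // -div1r ler_pdivlMr // mulrC.
exact: le_trans (gamma_hat_omega gamma w) lw.
Qed.

(** Light words have length at most [N_hat gamma], so the sum defining [exp_star] is the whole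
    exponential on them. *)
Lemma exp_star_restrict_light a : a [::] = 0 ->
  exp_star (restrict_light a) = restrict_light (wexp a).
Proof.
move=> a0; apply/funext => -[w lw]; rewrite /restrict_light /wexp /=.
rewrite -(wexp_upto_size a0 (size_light lw)); apply: eq_bigr => k _; congr (_ * _).
have -> // : iter k (star (restrict_light a)) (@counit R d gamma) = restrict_light (wpow a k).
by elim: (nat_of_ord k) => [|n IH] //; rewrite iterS IH star_restrict_light.
Qed.

Lemma pairing_sum (al : Ha_dual gamma) (T : Type) (s : seq T)
    (F : T -> tensor_space R d) :
  pairing al (\sum_(t <- s) F t) = \sum_(t <- s) pairing al (F t).
Proof.
exact: (big_morph (pairing al)
  (@mmapD _ _ _ idfun (word_pairing al)) (@mmap0 _ _ _ idfun _)).
Qed.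

Lemma pairing_monomial (al : Ha_dual gamma) c w :
  pairing al (mkmalgU w c) = c * word_pairing al w.
Proof. exact: (@mmapU _ _ _ idfun). Qed.

Lemma pairing_shuffle (al : Ha_dual gamma) x y : pairing al (shuffle x y) =
  \sum_(u <- finmap.enum_fset (msupp x))
    \sum_(v <- finmap.enum_fset (msupp y))
    mcoeff u x * mcoeff v y * shuffle_sum (word_pairing al) u v.
Proof.
rewrite /shuffle pairing_sum; apply: eq_bigr => u _.
rewrite pairing_sum; apply: eq_bigr => v _.
rewrite pairing_sum /shuffle_sum mulr_sumr; apply: eq_bigr => w _.
exact: pairing_monomial.
Qed.

Lemma omega_shuffle u v w : w \in word_shuffle u v ->
  omega gamma w = omega gamma u + omega gamma v.
Proof. by move/perm_word_shuffle => uv; rewrite /omega (perm_big _ uv) big_cat. Qed.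

(* The junk value 0 outside the light words is harmless: a shuffle of two
   nonempty words whose total weight exceeds 1 involves only heavy words. *)
Lemma restrict_light_primitive a : is_primitive a ->
  is_primitive (word_pairing (restrict_light a)).
Proof.
move=> pa u v; have [uv1|uv1] := leP (omega gamma u + omega gamma v) 1.
  have [lu lv] := @light_cat u v (eq_ind_r (fun x => is_true (x <= 1)) uv1 (omega_cat u v)).
  rewrite !restrict_lightE lu lv -pa; apply: eq_big_seq => w wuv.
  by rewrite restrict_lightE (omega_shuffle wuv) uv1.
have heavy u' v' : 1 < omega gamma u' + omega gamma v' ->
    word_pairing (restrict_light a) u' * unitw v' = 0 :> R.
  case: v' => [|b v']; last by rewrite /unitw mulr0.
  by rewrite restrict_lightE {2}/omega big_nil addr0 ltNge => /negPf ->; rewrite mul0r.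
rewrite heavy // mulrC heavy ?addr0; last by rewrite addrC.
rewrite /shuffle_sum big_seq big1 // => w wuv.
by rewrite restrict_lightE (omega_shuffle wuv) leNgt uv1.
Qed.

Lemma restrict_light_in_ga a : is_primitive a -> in_ga (restrict_light a).
Proof.
move=> /restrict_light_primitive pa x y _ _ _; rewrite pairing_shuffle.
have unitE w : word_pairing (@counit R d gamma) w = unitw w.
  rewrite counit_restrict_light restrict_lightE; case: ifP => //; case: w => //.
  by rewrite /omega big_nil ler01.
rewrite /pairing !mulr_suml -big_split; apply: eq_bigr => u _ /=.
rewrite !mulr_sumr -big_split; apply: eq_bigr => v _ /=.
by rewrite pa !unitE; ring.
Qed.

Lemma restrict_light_in_Ga X : is_character X -> in_Ga (restrict_light X).
Proof.
move=> cX; have [X1 _] := cX; exists (restrict_light (wlog X)).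
  exact/restrict_light_in_ga/wlog_primitive.
by rewrite exp_star_restrict_light ?wexp_wlog ?wlog_nil.
Qed.

Lemma omega_count w : omega gamma w = \sum_(i < d) (count_mem i w)%:R * gamma i.
Proof.
rewrite /omega; elim: w => [|a w IH].
  by rewrite big_nil big1 // => i _; rewrite mul0r.
rewrite big_cons IH (bigD1 a) //= [in RHS](bigD1 a) //= eqxx natrD mulrDl mul1r addrA.
by congr (_ + _); apply: eq_bigr => i /negPf ia; rewrite eq_sym ia.
Qed.
End LightWords.

(** * The rough path lift and translation *)

Section RoughPath.
Context {R : realType} {d : nat} (gamma : 'I_d -> R).

Lemma clamp_subproof (t : R) : 0 <= Num.max 0 (Num.min t 1) <= 1.
Proof. by rewrite le_max lexx ge_max ler01 ge_min lexx orbT. Qed.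

(** Extends paths to the whole line, as grid points may lie beyond 1; clamping is 1-Lipschitz, so
    Hölder bounds survive. *)
Definition clamp (t : R) : unit_interval R :=
  exist (fun s : R => is_true (0 <= s <= 1)) _ (clamp_subproof t).

Lemma clampK (t : unit_interval R) : clamp (val t) = t.
Proof.
case: t => t t01; apply: val_inj => /=; have /andP[t0 t1] := t01.
by rewrite min_l // max_r.
Qed.

Lemma clamp_lipschitz s t : `|val (clamp t) - val (clamp s)| <= `|t - s|.
Proof.
rewrite /= ler_norml.
have := ler_norm (t - s); have := ler_norm (s - t); rewrite distrC.
have l01 : (0 : R) < 1 := ltr01.
case: (leP t 1) => t1; case: (leP s 1) => s1; case: (leP 0 t) => t0;
  case: (leP 0 s) => s0; rewrite ?(max_r (ltW l01)) => *; apply/andP; split; lra.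
Qed.

(* Subtracting the initial value makes the construction depend on increments
   only, so that it can be recovered from its own first level. *)
Definition extend (x : path_collection R d) (i : 'I_d) (t : R) : R :=
  x i (clamp t) - x i (clamp 0).

Definition rough_lift (x : path_collection R d) : two_parameter_path gamma :=
  fun s t => restrict_light (increments (extend x) (val s) (val t)).

Definition first_level (X : two_parameter_path gamma) : path_collection R d :=
  fun i t => word_pairing (X (clamp 0) t) [:: i].

(** Reads nothing of [X] but its first level, so the action is a function of [g] and [X] alone, with
    no reference to an underlying [x]. *)
Definition translate (g : path_collection R d) (X : two_parameter_path gamma) :
    two_parameter_path gamma :=
  rough_lift (add_collection (first_level X) g).

Hypothesis gamma_bounds : forall i, 0 < gamma i < 1.
Hypothesis gamma_nonresonant :
  forall k : 'I_d -> nat, \sum_(i < d) (k i)%:R * gamma i != 1.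

Let gamma_gt0 i : 0 < gamma i. Proof. by case/andP: (gamma_bounds i). Qed.

Lemma extend_holder x : is_holder_collection gamma x ->
  forall i, exists2 C : R, 0 <= C &
    forall s t, `|extend x i t - extend x i s| <= C * `|t - s| `^ gamma i.
Proof.
move=> hx i; have [C hC] := hx i; exists `|C| => // s t.
rewrite /extend opprB addrA subrK; apply: le_trans (hC _ _) _.
apply: le_trans (ler_wpM2r (powR_ge0 _ _) (ler_norm C)) _.
apply: ler_wpM2l => //; apply: ge0_ler_powR; rewrite ?nnegrE ?(ltW (gamma_gt0 i)) //.
exact: clamp_lipschitz.
Qed.

Lemma rough_lift_over x : is_holder_collection gamma x -> is_over x (rough_lift x).
Proof.
move=> hx i [s s01] [t t01]; rewrite restrict_lightE /omega big_seq1.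
have /andP[_ /ltW ->] := gamma_bounds i.
have /andP[s0 _] := s01; have /andP[t0 _] := t01.
rewrite (increments_letter gamma_gt0 (extend_holder hx)) // /extend opprB addrA subrK.
by congr (x i _ - x i _); apply: clampK.
Qed.

Lemma rough_lift_rough_path x : is_holder_collection gamma x ->
  is_rough_path (rough_lift x).
Proof.
move=> /extend_holder hx; split=> [s t|s u t|[v lv]].
- exact/restrict_light_in_Ga/(increments_character gamma_gt0 hx).
- by rewrite star_restrict_light // (increments_conv gamma_gt0 hx).
(* Nonresonance, applied to the letter counts of [v], rules out weight exactly 1. *)
have v1 : omega gamma v < 1.
  by rewrite lt_neqAle lv andbT omega_count gamma_nonresonant.
have [C CP] := increments_holder gamma_gt0 hx v1.
exists C => -[s s01] [t t01] /=; have /andP[s0 s1] := s01; have /andP[t0 t1] := t01.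
by apply: (CP s t) => //; rewrite ler_norml; apply/andP; split; lra.
Qed.

Lemma add_collection_holder x g : is_holder_collection gamma x ->
  is_holder_collection gamma g -> is_holder_collection gamma (add_collection x g).
Proof.
move=> hx hg i; have [C hC] := hx i; have [D hD] := hg i; exists (C + D) => s t.
rewrite /add_collection opprD addrACA mulrDl.
exact: le_trans (ler_normD _ _) (lerD (hC s t) (hD s t)).
Qed.

Lemma rough_lift_extend x z : extend x = extend z -> rough_lift x = rough_lift z.
Proof. by rewrite /rough_lift => ->. Qed.

(** The first level of the lift is [x] minus its initial value, and [extend] cannot see this
    constant. *)
Lemma translate_rough_lift x g : is_holder_collection gamma x ->
  translate g (rough_lift x) = rough_lift (add_collection x g).
Proof.
move=> hx; apply: rough_lift_extend; apply/funext => i; apply/funext => t.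
by rewrite /extend /add_collection /first_level !(rough_lift_over hx); ring.
Qed.
End RoughPath.

Unset Implicit Arguments.

Theorem theorem1p5 (R : realType) (d : nat) (gamma : 'I_d -> R)
    (d_gt0 : (0 < d)%N)
    (gamma_bounds : forall i, 0 < gamma i < 1)
    (gamma_nonresonant :
       forall k : 'I_d -> nat, \sum_(i < d) (k i)%:R * gamma i != 1) :
  exists (Xbar : path_collection R d -> two_parameter_path gamma)
         (act : path_collection R d ->
                two_parameter_path gamma -> two_parameter_path gamma),
    [/\ forall x, is_holder_collection gamma x ->
          is_rough_path (Xbar x) /\ is_over x (Xbar x),
        forall x g, is_holder_collection gamma x ->
          is_holder_collection gamma g ->
          act g (Xbar x) = Xbar (add_collection x g)
      & forall x g g', is_holder_collection gamma x ->
          is_holder_collection gamma g -> is_holder_collection gamma g' ->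
          act g' (act g (Xbar x)) = act (add_collection g g') (Xbar x)].
Proof.
exists (@rough_lift R d gamma), (@translate R d gamma).
split=> [x hx|x g hx _|x g g' hx hg _].
- by split; [apply: rough_lift_rough_path | apply: rough_lift_over].
- exact: translate_rough_lift.
have hxg := add_collection_holder hx hg.
rewrite !translate_rough_lift //; congr (rough_lift _ _).
by apply/funext => i; apply/funext => t; rewrite /add_collection addrA.
Qed.
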